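(* Let $f:\mathbb{R}^n\to\mathbb{R}^n$, $h:\mathbb{R}^n\to\mathbb{R}^m$ and $F:\mathbb{R}^n\times\mathbb{R}^m\to\mathbb{R}^n$, and consider the interconnected system $$\dot x=f(x),\qquad \dot{\hat x}=F(\hat x,h(x)),\qquad (x,\hat x)\in\mathbb{R}^n\times\mathbb{R}^n .$$ Assume there exists a complete $C^3$ Riemannian metric $P$ on $\mathbb{R}^n$, with Riemannian distance $d$, such that for each $(\hat x,x)\in\mathbb{R}^n\times\mathbb{R}^n$ $$\mathfrak{D}^+ d(\hat x,x)\le 0$$ along any solution of the interconnected system. Then $$v^\top \mathcal{L}_fP(x)\,v\le 0\qquad\text{for all }(x,v)\in\mathbb{R}^n\times\mathbb{R}^n\text{ such that }\frac{\partial h}{\partial x}(x)\,v=0 .$$ Furthermore, if there exists a function $\omega:\mathbb{R}^n\times\mathbb{R}^n\to[0,+\infty)$ such that $(\hat x,x)\mapsto d(\hat x,x)\,\omega(\hat x,x)$ is a $C^2$ function on a neighborhood $\mathcal{N}_{\mathcal{A}}$ of $\mathcal{A}=\{(x,\hat x)\in\mathbb{R}^n\times\mathbb{R}^n: x=\hat x\}$ with the property that, for some $\varepsilon>0$, $$\frac{\partial^2 (d\,\omega)}{\partial \hat x^2}(x,x)\ge \varepsilon P(x)\qquad\forall x\in\mathbb{R}^n,$$ and, for each $(\hat x,x)\in\mathcal{N}_{\mathcal{A}}$, $$\mathfrak{D}^+ d(\hat x,x)\le-\omega(\hat x,x)$$ along any solution of the interconnected system, then there exists a continuous function $\rho:\mathbb{R}^n\to\mathbb{R}$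 satisfying $$\mathcal{L}_fP(x)\le \rho(x)\,\frac{\partial h}{\partial x}(x)^\top\frac{\partial h}{\partial x}(x)-\frac{\varepsilon}{2}P(x)\qquad\forall x\in\mathbb{R}^n .$$
   Context: Standing assumptions: all functions $f,h,F$ are differentiable sufficiently many times, and systems are forward complete (each solution exists on $[0,+\infty)$). A Riemannian metric on $\mathbb{R}^n$ is a symmetric covariant two-tensor $P:\mathbb{R}^n\to\mathbb{R}^{n\times n}$ (expressed in the given coordinates) with positive definite values. The length of a $C^1$ path $\gamma$ on $[s_1,s_2]$ is $\int_{s_1}^{s_2}\sqrt{\frac{d\gamma}{ds}(s)^\top P(\gamma(s))\frac{d\gamma}{ds}(s)}\,ds$, and the Riemannian distance $d(x_1,x_2)$ is the minimum (infimum) of the lengths of piecewise $C^1$ paths between $x_1$ and $x_2$. $P$ is complete if every geodesic can be maximally extended to $\mathbb{R}$. The Lie derivative $\mathcal{L}_fP(x)$ is the symmetric matrix such that, for all $v\in\mathbb{R}^n$, $$v^\top\mathcal{L}_fP(x)v=\frac{\partial}{\partial x}\big(v^\top P(x)v\big)f(x)+2\,v^\top P(x)\frac{\partial f}{\partial x}(x)v .$$ Denoting by $(X(x,t),\hat X((\hat x,x),t))$ the solution of the interconnected system issued from $(x,\hat x)$, the upper right-hand Dini derivative is $$\mathfrak{D}^+d(\hat x,x)=\limsup_{t\to0_+}\frac{d(\hat X((\hat x,x),t),X(x,t))-d(\hat x,x)}{t}.$$ $\frac{\partial^2(d\omega)}{\partial\hat x^2}(x,x)$ denotes the Hessian of $d\,\omega$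 with respect to its first argument $\hat x$, evaluated at $\hat x=x$. Inequalities between symmetric matrices are in the sense of quadratic forms. *)

(* Defs.v *)
From HB Require Import structures.
From mathcomp Require Import all_boot all_order all_algebra.
From mathcomp Require Import all_classical all_reals all_analysis.
From mathcomp Require Import ring.

Set Implicit Arguments.
Unset Strict Implicit.
Unset Printing Implicit Defensive.
Import Order.TTheory GRing.Theory Num.Theory.
Import numFieldNormedType.Exports.

Local Open Scope ring_scope.
Local Open Scope classical_set_scope.

(** Points and vectors of R^n are row vectors ['rV[R]_n], for which the library
    has ['J f x]. A column vector v is therefore [v^T] below. *)

Section Calculus.
Context {R : realType}.

(** C^k on an open set U: in finite dimension, a differentiable map is of class
    C^(k+1) iff all its directional derivatives are of class C^k. The definition
    is only meaningful for open U, as it uses two-sided derivatives. *)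
Fixpoint Ck_on (V W : normedModType R) (U : set V) (k : nat) (g : V -> W) :
    Prop :=
  if k is k'.+1 then
    (forall x, U x -> differentiable g x) /\
    (forall v, Ck_on U k' (fun x => 'D_v g x))
  else forall x, U x -> {for x, continuous g}.

Definition Ck (V W : normedModType R) (k : nat) (g : V -> W) : Prop :=
  Ck_on setT k g.

(** Derivative relative to A: one-sided at an end point of an interval A. *)
Definition has_derivative_in (V : normedModType R) (A : set R) (g : R -> V)
    (s : R) (l : V) : Prop :=
  (t - s)^-1 *: (g t - g s) @[t --> within A s^'] --> l.

(** The library's ['J g x] acts on row vectors from the right; its transpose is
    the usual matrix of partial derivatives (row i = gradient of g_i). *)
Definition jac n m (g : 'rV[R]_n -> 'rV[R]_m) (x : 'rV[R]_n) : 'M[R]_(m, n) :=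
  ('J g x)^T.

Definition hessian n (g : 'rV[R]_n -> R) (x : 'rV[R]_n) : 'M[R]_n :=
  \matrix_(i, j) 'D_(delta_mx 0 i) ('D_(delta_mx 0 j) g) x.

Definition qform n (A : 'M[R]_n) (v : 'rV[R]_n) : R := (v *m A *m v^T) 0 0.

Definition loewner_le n (A B : 'M[R]_n) : Prop :=
  forall v : 'rV[R]_n, qform A v <= qform B v.

End Calculus.

Section Riemannian.
Context {R : realType} {n : nat}.
Implicit Types (P : 'rV[R]_n -> 'M[R]_n) (x : 'rV[R]_n) (c : R -> 'rV[R]_n).

Definition riemannian_metric P : Prop :=
  forall x, (P x)^T = P x /\ forall v : 'rV[R]_n, v != 0 -> 0 < qform (P x) v.

Definition C1_path (a b : R) c : Prop :=
  exists dc : R -> 'rV[R]_n, {within `[a, b], continuous dc} /\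
    forall s, a <= s <= b -> has_derivative_in `[a, b] c s (dc s).

(** Consecutive closed pieces share their end points, so that such a path is
    continuous on [a, b]. *)
Definition piecewise_C1_path (a b : R) c : Prop :=
  exists2 p : seq R, itv_partition a b p &
    forall i, (i < size p)%N -> C1_path (nth b (a :: p) i) (nth b p i) c.

(** For a piecewise C^1 path, [derive1 c] is its velocity except at the finitely
    many end points of the pieces, which do not contribute to its length. *)
Definition speed P c (s : R) : R := Num.sqrt (qform (P (c s)) (derive1 c s)).

Definition path_length P (a b : R) c : R :=
  \int[lebesgue_measure]_(s in `[a, b]) speed P c s.

Definition riemannian_dist P (x1 x2 : 'rV[R]_n) : R :=
  inf [set l | exists a b c, [/\ a < b, piecewise_C1_path a b c,
                                 c a = x1, c b = x2 & l = path_length P a b c]].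

(** [christoffel P x k i j] is the symbol with upper index k. *)
Definition christoffel P x (k i j : 'I_n) : R :=
  let dP (l r s : 'I_n) := 'D_(delta_mx 0 l) (fun y => P y r s) x in
  2^-1 * \sum_(l < n) invmx (P x) k l * (dP i l j + dP j l i - dP l i j).

(** Solution of the geodesic equation on an open interval I. *)
Definition geodesic_on P (I : set R) c : Prop :=
  forall s, I s ->
    [/\ derivable c s 1, derivable (derive1 c) s 1 &
        forall k : 'I_n, derive1 (derive1 c) s 0 k +
          \sum_(i < n) \sum_(j < n)
            christoffel P (c s) k i j * derive1 c s 0 i * derive1 c s 0 j = 0].

Definition complete_metric P : Prop :=
  forall (I : set R) c, is_interval I -> open I -> geodesic_on P I c ->
    exists2 c' : R -> 'rV[R]_n, geodesic_on P setT c' &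
      forall s, I s -> c' s = c s.

Definition lie_derivative (f : 'rV[R]_n -> 'rV[R]_n) P x : 'M[R]_n :=
  get [set L : 'M[R]_n | L^T = L /\ forall v : 'rV[R]_n,
    qform L v = 'D_(f x) (fun y => qform (P y) v) x
                + 2 * (v *m P x *m jac f x *m v^T) 0 0].

Lemma qformE (A : 'M[R]_n) v : qform A v = \sum_j \sum_i v 0 i * A i j * v 0 j.
Proof.
rewrite /qform mxE; apply: eq_bigr => j _.
by rewrite !mxE mulr_suml.
Qed.

Lemma qformD (A B : 'M[R]_n) v : qform (A + B) v = qform A v + qform B v.
Proof. by rewrite /qform mulmxDr mulmxDl mxE. Qed.

Lemma qform_inj (A B : 'M[R]_n) : A^T = A -> B^T = B ->
  (forall v, qform A v = qform B v) -> A = B.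
Proof.
move=> At Bt AB.
have bilin (M : 'M[R]_n) i j : M^T = M ->
    qform M (delta_mx 0 i + delta_mx 0 j) =
    qform M (delta_mx 0 i) + qform M (delta_mx 0 j) + 2 * M i j.
  move=> Mt; rewrite /qform linearD /= !mulmxDl !mulmxDr.
  rewrite -!rowE !trmx_delta -!colE !mxE.
  have -> : M j i = M i j by rewrite -{1}Mt mxE.
  by ring.
apply/matrixP => i j.
have := AB (delta_mx 0 i + delta_mx 0 j).
rewrite (bilin A) // (bilin B) // !AB => /addrI /mulfI; apply.
by rewrite pnatr_eq0.
Qed.

(** The defining property has a unique solution, given by the usual formula. *)
Lemma lie_derivativeE (f : 'rV[R]_n -> 'rV[R]_n) P x :
  (forall y, (P y)^T = P y) -> differentiable P x ->
  lie_derivative f P x =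
    'D_(f x) P x + P x *m jac f x + (jac f x)^T *m P x.
Proof.
move=> Ps dP.
have dPmx v : derivable P x v by exact: diff_derivable.
have dPij i j v : derivable (fun y => P y i j) x v.
  by have /derivable_mxP := dPmx v; apply.
set D := 'D_(f x) P x.
have DE i j : D i j = 'D_(f x) (fun y => P y i j) x.
  by rewrite /D derive_mx // mxE.
have Ds : D^T = D.
  apply/matrixP => i j; rewrite mxE !DE; congr ('D_(f x) _ x).
  by apply/funext => y; rewrite -[in LHS](Ps y) mxE.
have Dq v : 'D_(f x) (fun y => qform (P y) v) x = qform D v.
  rewrite (_ : (fun y => _) =
      \sum_(j < n) \sum_(i < n) (v 0 i * v 0 j) \*: (fun y => P y i j)).
    rewrite derive_sum => [|j]; last first.
      by apply: derivable_sum => i; exact: derivableZ.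
    rewrite qformE; apply: eq_bigr => j _.
    rewrite derive_sum => [|i]; last exact: derivableZ.
    apply: eq_bigr => i _; rewrite deriveZ // DE.
    by rewrite [LHS]mulrAC.
  apply/funext => y; rewrite qformE fct_sumE; apply: eq_bigr => j _.
  rewrite fct_sumE; apply: eq_bigr => i _.
  by rewrite [RHS]mulrAC.
set L := D + _ + _.
have Ls : L^T = L.
  by rewrite /L !linearD /= !trmx_mul trmxK Ds Ps addrAC.
have Lq v : qform L v = 'D_(f x) (fun y => qform (P y) v) x
                + 2 * (v *m P x *m jac f x *m v^T) 0 0.
  rewrite /L !qformD Dq -addrA; congr (_ + _).
  rewrite mulr_natl mulr2n /qform !mulmxA; congr (_ + _).
  rewrite -[LHS]/(((_ : 'M[R]_1)) 0 0) -[in LHS](trmxK (v *m _ *m _ *m _)) mxE.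
  by rewrite !trmx_mul !trmxK Ps !mulmxA.
have [Gs Gq] : (lie_derivative f P x)^T = lie_derivative f P x /\
    forall v, qform (lie_derivative f P x) v =
      'D_(f x) (fun y => qform (P y) v) x
      + 2 * (v *m P x *m jac f x *m v^T) 0 0.
  by apply: (@getPex _ [set M : 'M[R]_n | M^T = M /\ forall v, _]); exists L.
by apply: qform_inj => // v; rewrite Gq Lq.
Qed.

End Riemannian.

Section Observer.
Context {R : realType} {n m : nat}.
Variables (f : 'rV[R]_n -> 'rV[R]_n) (h : 'rV[R]_n -> 'rV[R]_m)
  (F : 'rV[R]_n * 'rV[R]_m -> 'rV[R]_n).

(** (X, Xh) solves x' = f(x), xh' = F(xh, h(x)) on [0, +oo[ from (x, xh). *)
Definition solution_from (xh x : 'rV[R]_n) (Xh X : R -> 'rV[R]_n) : Prop :=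
  [/\ X 0 = x, Xh 0 = xh &
      forall t, 0 <= t ->
        has_derivative_in `[0, +oo[ X t (f (X t)) /\
        has_derivative_in `[0, +oo[ Xh t (F (Xh t, h (X t)))].

Definition forward_complete : Prop :=
  forall xh x, exists Xh X, solution_from xh x Xh X.

Definition dini_dist (P : 'rV[R]_n -> 'M[R]_n) (Xh X : R -> 'rV[R]_n) : \bar R :=
  limf_esup (fun t : R => ((riemannian_dist P (Xh t) (X t)
                            - riemannian_dist P (Xh 0) (X 0)) / t)%:E) 0^'+.

(** D^+ d(xh, x) <= r along any solution issued from (x, xh). *)
Definition dini_dist_le (P : 'rV[R]_n -> 'M[R]_n) (xh x : 'rV[R]_n) (r : R) :
    Prop :=
  forall Xh X, solution_from xh x Xh X -> (dini_dist P Xh X <= r%:E)%E.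

End Observer.

(* Main.v *)
Require Import Defs.
From HB Require Import structures.
From mathcomp Require Import all_boot all_order all_algebra.
From mathcomp Require Import all_classical all_reals all_analysis.
From mathcomp Require Import measurable_realfun ring lra.

Set Implicit Arguments.
Unset Strict Implicit.
Unset Printing Implicit Defensive.
Import Order.TTheory GRing.Theory Num.Theory.
Import numFieldNormedType.Exports.
Local Open Scope ring_scope.
Local Open Scope classical_set_scope.

(** The theorem reduces to an inequality on infinitesimal errors. Write A(x) for
    the derivative of F in its first argument at (x, h(x)). Since the distance
    does not increase along solutions that start on the diagonal, the two
    components of such a solution stay equal to first order, whence
    F(x, h(x)) = f(x) ([drift_eq]). The error between the components of the
    solution that starts from (x + s v, x) is then s (v + t A(x) v), up to
    s o(t), uniformly in s ([flow_expansion]).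

    Near the diagonal, the squared distance between y and z is the quadratic form
    of P(y) at z - y up to a cubic error ([dist_sqr_near_diagonal]). This uses
    no geodesic: the upper bound is the length of a segment, and the lower bound
    is certified, for all paths at once, by a function of the Riemannian norm
    |z - y| given by P(y) that is 1-Lipschitz for the metric and levels off away
    from y ([dist_ge_near_diagonal]).

    With s = t^2, integrating the bound on the Dini derivative over [0, t],
    dividing by s^2 t and letting t tend to 0 gives, for every v,
    D_f (v^T P v) + 2 v^T P A v <= - kappa v^T P v ([variational_inequality]).
    Here kappa = 0 for the first claim. For the second one, d omega is
    nonnegative and vanishes on the diagonal, so its Hessian bounds it below by
    kappa / 2 times the quadratic form of P, for any kappa < eps
    ([dist_omega_ge_near_diagonal]); this bounds the decrease of the squared
    distance, whose Dini derivative is at most - 2 d omega.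

    Finally, the derivative of F(x, h(x)) = f(x) along v reads
    df v = A v + B (dh v), where B is the derivative of F in its second argument.
    On the kernel of dh the variational inequality is therefore the first claim.
    In general the Lie derivative has the additional term 2 v^T P B (dh v), and
    Young's inequality bounds it by a small multiple of v^T P v plus rho |dh v|^2
    ([lie_derivative_le]), where rho is an explicit expression in P and B, hence
    continuous. *)

(** * Positive definite quadratic forms *)

Section QuadraticForms.
Context {R : realType} {n : nat}.
Implicit Types (Q : 'M[R]_n) (u v w : 'rV[R]_n).

Definition bil Q u v : R := (u *m Q *m v^T) 0 0.

Definition pos_def Q : Prop := forall v, v != 0 -> 0 < qform Q v.

Definition qnorm Q u : R := Num.sqrt (qform Q u).

Lemma bilE Q u v : bil Q u v = \sum_j \sum_i u 0 i * Q i j * v 0 j.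
Proof.
by rewrite /bil mxE; apply: eq_bigr => j _; rewrite !mxE mulr_suml.
Qed.

Lemma bilDl Q u v w : bil Q (u + v) w = bil Q u w + bil Q v w.
Proof. by rewrite /bil !mulmxDl mxE. Qed.

Lemma bilDr Q u v w : bil Q u (v + w) = bil Q u v + bil Q u w.
Proof. by rewrite /bil linearD /= mulmxDr mxE. Qed.

Lemma bilZl Q a u v : bil Q (a *: u) v = a * bil Q u v.
Proof. by rewrite /bil -!scalemxAl mxE. Qed.

Lemma bilZr Q a u v : bil Q u (a *: v) = a * bil Q u v.
Proof. by rewrite /bil linearZ /= -scalemxAr mxE. Qed.

Lemma bilZm Q a u v : bil (a *: Q) u v = a * bil Q u v.
Proof. by rewrite /bil -scalemxAr -scalemxAl mxE. Qed.

Lemma bilBm Q Q' u v : bil (Q - Q') u v = bil Q u v - bil Q' u v.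
Proof. by rewrite /bil mulmxBr mulmxBl !mxE. Qed.

Lemma bil_sumr Q u k (v : 'I_k -> 'rV[R]_n) :
  bil Q u (\sum_i v i) = \sum_i bil Q u (v i).
Proof. by rewrite /bil linear_sum mulmx_sumr summxE. Qed.

Lemma bilC Q u v : Q^T = Q -> bil Q u v = bil Q v u.
Proof.
move=> Qs; rewrite /bil -[in LHS](trmxK (u *m Q *m v^T)) mxE.
by rewrite !trmx_mul !trmxK Qs mulmxA.
Qed.

Lemma qform_bil Q u : qform Q u = bil Q u u.
Proof. by []. Qed.

Lemma qformZ Q a u : qform Q (a *: u) = a ^+ 2 * qform Q u.
Proof. by rewrite !qform_bil bilZl bilZr mulrA. Qed.

Lemma qform0 Q : qform Q 0 = 0.
Proof. by rewrite -(scale0r 0) qformZ expr0n mul0r. Qed.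

Lemma qformN Q u : qform Q (- u) = qform Q u.
Proof. by rewrite -scaleN1r qformZ sqrrN expr1n mul1r. Qed.

Lemma qformDv Q u v : Q^T = Q ->
  qform Q (u + v) = qform Q u + 2 * bil Q u v + qform Q v.
Proof.
move=> Qs; rewrite !qform_bil bilDl !bilDr (bilC v u Qs); ring.
Qed.

Lemma qform_ge0 Q u : pos_def Q -> 0 <= qform Q u.
Proof.
by move=> Qp; have [->|/Qp/ltW//] := eqVneq u 0; rewrite qform0.
Qed.

(** Young's inequality, from q(a u - b v) >= 0. *)
Lemma bil_young Q u v (a b : R) : Q^T = Q -> pos_def Q ->
  2 * (a * b) * bil Q u v <= a ^+ 2 * qform Q u + b ^+ 2 * qform Q v.
Proof.
move=> Qs Qp; have := qform_ge0 (a *: u + (- b) *: v) Qp.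
rewrite qformDv // !qformZ bilZl bilZr; set x := qform _ _; set y := qform _ _.
by set z := bil _ _ _; nra.
Qed.

Lemma qnorm_ge0 Q u : 0 <= qnorm Q u.
Proof. exact: sqrtr_ge0. Qed.

Lemma qnormK Q u : pos_def Q -> qnorm Q u ^+ 2 = qform Q u.
Proof. by move=> Qp; rewrite sqr_sqrtr// qform_ge0. Qed.

Lemma qnorm0 Q : qnorm Q 0 = 0.
Proof. by rewrite /qnorm qform0 sqrtr0. Qed.

Lemma qnormZ Q a u : qnorm Q (a *: u) = `|a| * qnorm Q u.
Proof.
by rewrite /qnorm qformZ sqrtrM ?sqr_ge0// sqrtr_sqr.
Qed.

Lemma qnormN Q u : qnorm Q (- u) = qnorm Q u.
Proof. by rewrite /qnorm qformN. Qed.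

Lemma bil_le_qnorm Q u v : Q^T = Q -> pos_def Q ->
  bil Q u v <= qnorm Q u * qnorm Q v.
Proof.
move=> Qs Qp.
have [u0|u0] := eqVneq u 0.
  by rewrite u0 qnorm0 mul0r /bil !mul0mx mxE.
have [v0|v0] := eqVneq v 0.
  by rewrite v0 qnorm0 mulr0 /bil trmx0 mulmx0 mxE.
have gu : 0 < qnorm Q u by rewrite sqrtr_gt0 Qp.
have gv : 0 < qnorm Q v by rewrite sqrtr_gt0 Qp.
have := bil_young u v (qnorm Q v) (qnorm Q u) Qs Qp.
rewrite -!qnormK// => H.
rewrite -(ler_pM2l (_ : 0 < 2 * (qnorm Q v * qnorm Q u))); last first.
  by rewrite !mulr_gt0.
by apply: le_trans H _; rewrite le_eqVlt; apply/orP; left; apply/eqP; ring.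
Qed.

Lemma qnormD Q u v : Q^T = Q -> pos_def Q ->
  qnorm Q (u + v) <= qnorm Q u + qnorm Q v.
Proof.
move=> Qs Qp; rewrite -(ler_pXn2r (_ : 0 < 2)%N) ?nnegrE ?addr_ge0 ?qnorm_ge0//.
rewrite qnormK// qformDv// -!qnormK// sqrrD -mulr_natl.
by have := bil_le_qnorm u v Qs Qp; lra.
Qed.

Lemma mx_entry_le m k (M : 'M[R]_(m, k)) i j : `|M i j| <= `|M|.
Proof.
rewrite [leRHS]/Num.norm/= mx_normrE.
by rewrite (bigmax_sup (i, j))//=.
Qed.

Lemma mx_norm_le m k (M : 'M[R]_(m, k)) (a : R) : 0 <= a ->
  (forall i j, `|M i j| <= a) -> `|M| <= a.
Proof.
move=> a0 Ma; rewrite [leLHS]/Num.norm/= mx_normrE.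
by apply: bigmax_le => // -[i j] _; exact: Ma.
Qed.

Lemma bil_le Q u v : `|bil Q u v| <= n%:R ^+ 2 * `|Q| * `|u| * `|v|.
Proof.
rewrite bilE (le_trans (ler_norm_sum _ _ _))//.
apply: (@le_trans _ _ (\sum_(j < n) \sum_(i < n) `|Q| * `|u| * `|v|)).
  apply: ler_sum => j _.
  rewrite (le_trans (ler_norm_sum _ _ _))//; apply: ler_sum => i _.
  rewrite !normrM ler_pM// ?mulr_ge0// ?mx_entry_le// (mulrC `|Q|).
  by rewrite ler_pM// mx_entry_le.
rewrite !sumr_const card_ord -!mulrnA -[leLHS]mulr_natl expr2 natrM.
by rewrite !mulrA.
Qed.

Lemma qform_le Q u : `|qform Q u| <= n%:R ^+ 2 * `|Q| * `|u| ^+ 2.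
Proof. by rewrite expr2 mulrA bil_le. Qed.

(** The i-th coordinate of u is the inner product of u with Q^-1 e_i, so
    Cauchy-Schwarz bounds it by a multiple of the Q-norm of u. *)
Lemma pos_def_coercive Q : Q^T = Q -> pos_def Q ->
  exists2 c : R, 0 < c & forall u, c * `|u| ^+ 2 <= qform Q u.
Proof.
move=> Qs Qp.
have Qu : Q \in unitmx.
  rewrite -row_free_unit -kermx_eq0; apply/eqP/row_matrixP => i; rewrite row0.
  apply/eqP/negP => /negP k0; have := Qp _ k0.
  by rewrite /qform -row_mul mulmx_ker row0 mul0mx mxE ltxx.
pose b i : 'rV[R]_n := delta_mx 0 i *m invmx Q.
have coord u i : u 0 i = bil Q u (b i).
  rewrite /bil /b trmx_mul trmx_inv Qs -mulmxA (mulmxA Q) mulmxV//.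
  by rewrite mul1mx trmx_delta -colE mxE.
pose C := 1 + \sum_i qform Q (b i).
have C0 : 0 < C by rewrite ltr_pwDl// sumr_ge0// => i _; exact: qform_ge0.
exists C^-1; first by rewrite invr_gt0.
move=> u; rewrite ler_pdivrMl//.
suff : `|u| <= Num.sqrt (C * qform Q u).
  move=> /(lerXn2r 2); rewrite !nnegrE sqrtr_ge0 normr_ge0 => /(_ isT isT).
  by rewrite sqr_sqrtr//; apply: mulr_ge0; [exact: ltW|exact: qform_ge0].
apply: mx_norm_le; first exact: sqrtr_ge0.
move=> i j; rewrite ord1 -sqrtr_sqr; apply: ler_wsqrtr.
have -> : u 0 j ^+ 2 = bil Q u (b j) ^+ 2 by rewrite coord.
have CS w : bil Q u w ^+ 2 <= qform Q u * qform Q w.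
  rewrite -!qnormK// -exprMn -real_normK ?num_real//.
  rewrite lerXn2r ?nnegrE ?mulr_ge0 ?qnorm_ge0//.
  rewrite ler_norml bil_le_qnorm// andbT lerNl.
  have := bil_le_qnorm u (- w) Qs Qp; rewrite qnormN.
  by rewrite -scaleN1r bilZr mulN1r.
rewrite mulrC (le_trans (CS _))// ler_wpM2l ?qform_ge0//.
rewrite /C (bigD1 j)//= addrCA lerDl addr_ge0// sumr_ge0// => k _.
exact: qform_ge0.
Qed.

End QuadraticForms.

(** * Real induction and one-sided derivatives *)

Section RealInduction.
Context {R : realType}.
Implicit Types (a b t s : R).

(** The supremum of the times up to which Q holds is such a time by the closing
    hypothesis, and is not smaller than b by the opening one. *)
Lemma real_induction a b (Q : R -> Prop) :
  Q a ->
  (forall t, a <= t < b -> (forall s, a <= s <= t -> Q s) ->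
     \forall s \near t^'+, Q s) ->
  (forall t, a < t <= b -> (forall s, a <= s < t -> Q s) -> Q t) ->
  forall t, a <= t <= b -> Q t.
Proof.
move=> Qa Qr Ql t /andP[at_ tb].
have ab : a <= b by exact: le_trans tb.
pose S := [set x | a <= x <= b /\ forall s, a <= s <= x -> Q s].
have Sa : S a.
  by split=> [|s]; [rewrite lexx ab|rewrite -eq_le => /eqP <-].
have Sub : has_ubound S by exists b => x [/andP[]].
have hS : has_sup S by split; [exists a|].
have am : a <= sup S by exact: ub_le_sup.
have mb : sup S <= b by apply: ge_sup; [exists a|move=> x [/andP[]]].
have Qlt s : a <= s < sup S -> Q s.
  move=> /andP[as_ sm]; have s0 : 0 < sup S - s by rewrite subr_gt0.
  have [x [_ Sx]] := sup_adherent s0 hS; rewrite subKr => sx.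
  by apply: Sx; rewrite as_ ltW.
have Qm : Q (sup S).
  move: am; rewrite le_eqVlt => /predU1P[<-//|am]; apply: Ql; first exact/andP.
  by move=> s; exact: Qlt.
have Qle s : a <= s <= sup S -> Q s.
  move=> /andP[as_]; rewrite le_eqVlt => /predU1P[->//|sm].
  by apply: Qlt; rewrite as_.
have [eb|nb] := eqVneq (sup S) b; first by apply: Qle; rewrite eb at_.
have mltb : sup S < b by rewrite lt_neqAle nb.
have := Qr (sup S); rewrite am mltb => /(_ isT Qle) [e /= e0 He].
have [d [d0 de db]] : exists d, [/\ 0 < d, d < e & sup S + d <= b].
  exists (Num.min (e / 2) (b - sup S)); split.
  - by rewrite lt_min divr_gt0//= subr_gt0.
  - by rewrite gt_min ltr_pdivrMr// ltr_pMr// ltr1n.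
  - by rewrite -lerBrDl ge_min lexx orbT.
suff : S (sup S + d).
  by move=> /(ub_le_sup Sub); rewrite gerDl leNgt d0.
split; first by rewrite db andbT (le_trans am)// lerDl ltW.
move=> s /andP[as_ sd]; have [sm|ms] := leP s (sup S).
  by apply: Qle; rewrite as_.
apply: He => //=; rewrite ltr0_norm ?subr_lt0// opprB ltrBlDl.
by rewrite (le_lt_trans sd)// ltrD2l.
Qed.

Definition right_derivative (V : normedModType R) (g : R -> V) t (l : V) :=
  (s - t)^-1 *: (g s - g t) @[s --> t^'+] --> l.

Definition left_continuous (V : normedModType R) (g : R -> V) t :=
  g s @[s --> t^'-] --> g t.

Lemma right_derivative_near (V : normedModType R) (g : R -> V) t (l : V) e :
  right_derivative g t l -> 0 < e ->
  \forall s \near t^'+, `|g s - g t - (s - t) *: l| <= e * (s - t).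
Proof.
move=> gl e0; near=> s.
have st : 0 < s - t by rewrite subr_gt0; near: s; exact: nbhs_right_gt.
have : `|l - (s - t)^-1 *: (g s - g t)| <= e.
  by near: s; move/cvgrPdist_le : gl; exact.
rewrite -(ler_pM2r st); apply: le_trans.
rewrite -[X in _ <= _ * X]gtr0_norm// mulrC -normrZ scalerBr scalerA.
by rewrite divff ?gt_eqF// scale1r distrC.
Unshelve. all: by end_near. Qed.

Lemma right_derivativeD (V : normedModType R) (g1 g2 : R -> V) t l1 l2 :
  right_derivative g1 t l1 -> right_derivative g2 t l2 ->
  right_derivative (fun s => g1 s + g2 s) t (l1 + l2).
Proof.
move=> d1 d2; rewrite /right_derivative.
under eq_fun do rewrite opprD addrACA scalerDr.
exact: cvgD.
Qed.

Lemma right_derivativeN (V : normedModType R) (g : R -> V) t l :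
  right_derivative g t l -> right_derivative (fun s => - g s) t (- l).
Proof.
move=> d; rewrite /right_derivative.
under eq_fun do rewrite -opprD scalerN.
exact: cvgN.
Qed.

Lemma right_derivative_linear (V : normedModType R) (l : V) t :
  right_derivative (fun s => s *: l) t l.
Proof.
rewrite /right_derivative; apply: cvg_near_cst; near=> s.
have st : s - t != 0.
  by rewrite gt_eqF// subr_gt0; near: s; exact: nbhs_right_gt.
by rewrite -scalerBl scalerA mulVf// scale1r.
Unshelve. all: by end_near. Qed.

Lemma has_derivative_in_right (V : normedModType R) (A : set R) (g : R -> V)
    t (l : V) :
  (\forall s \near t^'+, A s) -> has_derivative_in A g t l ->
  right_derivative g t l.
Proof.
move=> tA; apply: cvg_trans; apply: cvg_app => B [e /= e0 eB].
case: tA => e' /= e'0 e'A.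
exists (Num.min e e'); first by rewrite /= lt_min e0.
move=> s; rewrite /ball_/= lt_min => /andP[se se'] ts.
by apply: eB => //=; [rewrite gt_eqF|exact: e'A].
Qed.

Lemma cvg_id_left t : s @[s --> t^'-] --> t.
Proof. by apply: cvg_at_left_filter; exact: cvg_id. Qed.

Lemma has_derivative_in_left (V : normedModType R) (A : set R) (g : R -> V)
    t (l : V) :
  (\forall s \near t^'-, A s) -> has_derivative_in A g t l ->
  left_continuous g t.
Proof.
move=> tA gl.
have {gl} gl : (s - t)^-1 *: (g s - g t) @[s --> t^'-] --> l.
  move: gl; apply: cvg_trans; apply: cvg_app => B [e /= e0 eB].
  case: tA => e' /= e'0 e'A.
  exists (Num.min e e'); first by rewrite /= lt_min e0.
  move=> s; rewrite /ball_/= lt_min => /andP[se se'] ts.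
  by apply: eB => //=; [rewrite lt_eqF|exact: e'A].
have d0 : s - t @[s --> t^'-] --> 0.
  rewrite -[X in _ --> X](subrr t).
  by apply: cvgB; [exact: cvg_id_left|exact: cvg_cst].
have h : (s - t) *: ((s - t)^-1 *: (g s - g t)) + g t @[s --> t^'-] -->
    0 *: l + g t by apply: cvgD; [exact: cvgZ|exact: cvg_cst].
rewrite /left_continuous -[X in _ --> X]add0r -(scale0r l).
apply: cvg_trans h; apply: near_eq_cvg; near=> s.
have st : s - t != 0.
  by rewrite lt_eqF// subr_lt0; near: s; exact: nbhs_left_lt.
by rewrite /= scalerA divff// scale1r subrK.
Unshelve. all: by end_near. Qed.

(** The increment bound is conditional on the conclusion at the current time,
    so that the lemma serves for trapping arguments, in which a bound on the
    speed holds as long as the curve stays in a ball. *)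
Lemma growth_le (U : R -> R) (a b c u0 : R) :
  U a <= u0 ->
  (forall t, a < t <= b -> left_continuous U t) ->
  (forall t, a <= t < b -> U t <= u0 + c * (t - a) ->
     \forall s \near t^'+, U s <= U t + c * (s - t)) ->
  forall t, a <= t <= b -> U t <= u0 + c * (t - a).
Proof.
move=> Ua Ul Ur; apply: real_induction.
- by rewrite subrr mulr0 addr0.
- move=> t tab Q; have at_ : a <= t by case/andP: tab.
  have Qt : U t <= u0 + c * (t - a) by apply: Q; rewrite lexx andbT.
  apply: filterS (Ur t tab Qt) => s Us.
  by apply: le_trans Us _; move: Qt; rewrite !mulrBr; lra.
- move=> t /andP[at_ tb] Q.
  have cl : u0 + c * (s - a) @[s --> t^'-] --> u0 + c * (t - a).
    apply: cvgD; first exact: cvg_cst.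
    apply: cvgM; first exact: cvg_cst.
    by apply: cvgB; [exact: cvg_id_left|exact: cvg_cst].
  apply: (ler_cvg_to _ cl); first by apply: Ul; rewrite at_.
  near=> s; apply: Q; apply/andP; split; near: s; last exact: nbhs_left_lt.
  exact: nbhs_left_ge.
Unshelve. all: by end_near. Qed.

Lemma left_continuous_norm (V : normedModType R) (g : R -> V) (v : V) t :
  left_continuous g t -> left_continuous (fun s => `|g s - v|) t.
Proof. by move=> gt; apply: cvg_norm; apply: cvgB => //; exact: cvg_cst. Qed.

(** The curve cannot cover the distance rho before the time rho / M, hence the
    speed bound, valid in the ball of radius rho, applies up to the time b. *)
Lemma trapped_curve (V : normedModType R) (g g' : R -> V) (a b M rho : R) :
  0 <= M -> M * (b - a) <= rho ->
  (forall t, a < t <= b -> left_continuous g t) ->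
  (forall t, a <= t < b -> right_derivative g t (g' t)) ->
  (forall t, a <= t < b -> `|g t - g a| <= rho -> `|g' t| < M) ->
  forall t, a <= t <= b -> `|g t - g a| <= M * (t - a).
Proof.
move=> M0 Mb gl gr gM t tab.
have := @growth_le (fun s => `|g s - g a|) a b M 0 _ _ _ t tab.
rewrite add0r; apply.
- by rewrite subrr normr0.
- by move=> s sab; apply: left_continuous_norm; exact: gl.
move=> s sab; rewrite add0r => gs.
have lt_M : `|g' s| < M.
  apply: gM => //; apply: le_trans gs _; apply: le_trans Mb.
  by rewrite ler_wpM2l// lerD2r; case/andP: sab => _ /ltW.
have e0 : 0 < M - `|g' s| by rewrite subr_gt0.
have := right_derivative_near (gr _ sab) e0.
apply: filterS2 (nbhs_right_gt s) => x sx Hx.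
have -> : g x - g a = (g x - g s - (x - s) *: g' s) + (x - s) *: g' s +
    (g s - g a) by rewrite subrK addrA subrK.
rewrite (le_trans (ler_normD _ _))// addrC lerD2l.
rewrite (le_trans (ler_normD _ _))// normrZ gtr0_norm ?subr_gt0//.
by move: Hx; rewrite [leRHS]mulrBl (mulrC `|g' s|); lra.
Qed.

End RealInduction.

(** * Mean value estimates for maps of class C^1 and C^2 *)

Section Calculus.
Context {R : realType}.

Lemma is_derive_line (V W : normedModType R) (g : V -> W) (p w : V) (r : R) :
  derivable g (p + r *: w) w ->
  is_derive r 1 (fun s => g (p + s *: w)) ('D_w g (p + r *: w)).
Proof.
have E : (fun h : R => h^-1 *: ((fun s => g (p + s *: w)) (h *: 1%R + r) -
      (fun s => g (p + s *: w)) r)) =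
    (fun h : R => h^-1 *: (g (h *: w + (p + r *: w)) - g (p + r *: w))).
  apply/funext => h /=; congr (_ *: (g _ - _)).
  by rewrite scalerDl [h *: 1%R]mulr1 addrCA.
by move=> dg; split; rewrite /derivable /derive E.
Qed.

Lemma is_derive_line_continuous (V W : normedModType R) (g : V -> W) (p w : V)
    (a b : R) :
  (forall r, a <= r <= b -> derivable g (p + r *: w) w) ->
  {within `[a, b], continuous (fun s => g (p + s *: w))}.
Proof.
move=> dg; apply/continuous_in_subspaceT => r; rewrite inE/= in_itv/= => rab.
apply/differentiable_continuous/derivable1_diffP.
by have [] := is_derive_line (dg r rab).
Qed.

Lemma ball_segment (V : normedModType R) (p0 p w : V) (d r : R) :
  `|p0 - p| < d -> `|p0 - (p + w)| < d -> 0 <= r <= 1 ->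
  `|p0 - (p + r *: w)| < d.
Proof.
move=> h0 h1 /andP[r0 r1].
have -> : p0 - (p + r *: w) = (1 - r) *: (p0 - p) + r *: (p0 - (p + w)).
  rewrite !opprD !(addrA p0) (scalerBr r) addrA -scalerDl subrK.
  by rewrite scale1r.
rewrite (le_lt_trans (ler_normD _ _))// !normrZ !ger0_norm ?subr_ge0//.
have [->|rn1] := eqVneq r 1; first by rewrite subrr mul0r add0r mul1r.
have r1' : r < 1 by rewrite lt_neqAle rn1.
have : (1 - r) * `|p0 - p| < (1 - r) * d by rewrite ltr_pM2l// subr_gt0.
have : r * `|p0 - (p + w)| <= r * d by rewrite ler_wpM2l// ltW.
lra.
Qed.

Section Directions.
Context {n : nat} {V : normedModType R} (L : {linear 'rV[R]_n -> V}).

Lemma derive_linear_dir (W : normedModType R) (g : V -> W) q w :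
  differentiable g q ->
  'D_(L w) g q = \sum_i w 0 i *: 'D_(L (delta_mx 0 i)) g q.
Proof.
move=> dg; rewrite deriveE// {1}(row_sum_delta w) linear_sum/= linear_sum/=.
by apply: eq_bigr => i _; rewrite !linearZ/= deriveE.
Qed.

(** Along the segment the mean value theorem expresses the increment by the
    derivative at an intermediate point; continuity at p0 of the finitely many
    derivatives in the directions [L e_i] makes the error uniform in [w]. *)
Lemma strict_differentiability k l (g : V -> 'M[R]_(k, l)) p0 :
  (forall q, differentiable g q) ->
  (forall i, {for p0, continuous ('D_(L (delta_mx 0 i)) g)}) ->
  forall e, 0 < e -> exists2 d, 0 < d & forall p w,
    `|p0 - p| < d -> `|p0 - (p + L w)| < d ->
    `|g (p + L w) - g p - 'D_(L w) g p0| <= e * `|w|.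
Proof.
move=> dg cg e e0.
(* n.+1 is used for n, which may be 0 *)
have e'0 : 0 < e / n.+1%:R by rewrite divr_gt0.
have : \forall q \near p0, forall i,
    `|'D_(L (delta_mx 0 i)) g p0 - 'D_(L (delta_mx 0 i)) g q| <= e / n.+1%:R.
  by apply: filter_forall => i; move/cvgrPdist_le : (cg i); exact.
move=> /nbhs_ballP[d /= d0 Hd]; exists d => // p w pd pwd.
apply: mx_norm_le; first by rewrite mulr_ge0// ltW.
move=> i j; rewrite !mxE.
pose gij q := g q i j.
have drv q v : derivable gij q v.
  have dgq : derivable g q v by exact: diff_derivable.
  by have /derivable_mxP := dgq; apply.
have gijE q v : 'D_v gij q = 'D_v g q i j.
  by rewrite derive_mx ?mxE//; exact: diff_derivable.
have [r /andP[r0 r1] ->] : exists2 r : R, 0 <= r <= 1 &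
    g (p + L w) i j - g p i j = 'D_(L w) gij (p + r *: L w).
  have [||r] := @MVT_segment R (fun s => gij (p + s *: L w))
    (fun s => 'D_(L w) gij (p + s *: L w)) 0 1 ler01.
  - by move=> s _; apply: is_derive_line.
  - by apply: is_derive_line_continuous => s _.
  rewrite in_itv/= scale1r scale0r addr0 subr0 mulr1 => r01 E.
  by exists r.
rewrite gijE; set q := p + r *: L w.
have qd : `|p0 - q| < d by apply: ball_segment => //; rewrite r0.
rewrite !derive_linear_dir// !summxE -sumrB.
rewrite (le_trans (ler_norm_sum _ _ _))//.
apply: (@le_trans _ _ (\sum_(c < n) `|w| * (e / n.+1%:R))).
  apply: ler_sum => c _; rewrite !mxE -mulrBr normrM ler_pM ?mx_entry_le//.
  have := Hd q; rewrite -ball_normE => /(_ qd c); rewrite distrC; apply: le_trans.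
  by rewrite (le_trans _ (mx_entry_le _ i j))// !mxE.
rewrite sumr_const card_ord -[leLHS]mulr_natr -mulrA [leLHS]mulrC.
by rewrite ler_wpM2r// mulrAC ler_pdivrMr ?ltr0n// ler_pM2l// ler_nat.
Qed.

Lemma locally_lipschitz k l (g : V -> 'M[R]_(k, l)) p0 :
  (forall q, differentiable g q) ->
  (forall i, {for p0, continuous ('D_(L (delta_mx 0 i)) g)}) ->
  exists2 K, 0 < K & exists2 d, 0 < d & forall p w,
    `|p0 - p| < d -> `|p0 - (p + L w)| < d -> `|g (p + L w) - g p| <= K * `|w|.
Proof.
move=> dg cg.
exists (1 + \sum_i `|'D_(L (delta_mx 0 i)) g p0|).
  by rewrite ltr_pwDl// sumr_ge0.
have [d d0 H] := strict_differentiability dg cg ltr01.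
exists d => // p w pd pwd; have := H p w pd pwd.
rewrite mul1r mulrDl mul1r => {}H.
rewrite -[X in `|X|](subrK ('D_(L w) g p0)) (le_trans (ler_normD _ _))//.
rewrite lerD// derive_linear_dir// (le_trans (ler_norm_sum _ _ _))//.
rewrite mulr_suml; apply: ler_sum => i _.
by rewrite normrZ mulrC ler_wpM2l// mx_entry_le.
Qed.

Lemma derive2_linear_dir (N : set V) (g : V -> R) q w :
  open N -> N q -> Ck_on N 2 g ->
  'D_(L w) ('D_(L w) g) q = \sum_i \sum_j w 0 i * w 0 j *
    'D_(L (delta_mx 0 i)) ('D_(L (delta_mx 0 j)) g) q.
Proof.
move=> oN Nq [dg C1g].
have dDg v : differentiable ('D_v g) q by exact: (C1g v).1.
rewrite derive_linear_dir//; apply: eq_bigr => i _.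
have -> : 'D_(L (delta_mx 0 i)) ('D_(L w) g) q =
    'D_(L (delta_mx 0 i)) (\sum_j w 0 j \*: 'D_(L (delta_mx 0 j)) g) q.
  apply: near_eq_derive; near=> q'; rewrite derive_linear_dir; last first.
    by apply: dg; near: q'; exact: open_nbhs_nbhs.
  by rewrite fct_sumE.
rewrite derive_sum => [|j]; last by apply: derivableZ; exact: diff_derivable.
rewrite scaler_sumr; apply: eq_bigr => j _.
by rewrite deriveZ; [rewrite -mulrA|exact: diff_derivable].
Unshelve. all: by end_near. Qed.

(** The mean value theorem is applied twice along the segment. The second
    derivative in the direction [L w] is a quadratic form in [w] with finitely
    many continuous coefficients, hence the uniformity in [p] and [w]. *)
Lemma taylor2_lower (N : set V) (g : V -> R) p0 :
  open N -> N p0 -> Ck_on N 2 g ->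
  forall e, 0 < e -> exists2 d, 0 < d & forall p w,
    `|p0 - p| < d -> `|p0 - (p + L w)| < d ->
    N p /\
    g p + 'D_(L w) g p
      + ('D_(L w) ('D_(L w) g) p0 - e * `|w| ^+ 2) / 2 <= g (p + L w).
Proof.
move=> oN Np0 [dg C1g] e e0.
have dDg v q : N q -> differentiable ('D_v g) q by move=> Nq; exact: (C1g v).1.
have cDDg u v q : N q -> {for q, continuous ('D_u ('D_v g))}.
  by move=> Nq; exact: (C1g v).2.
pose b i : V := L (delta_mx 0 i).
have DDE q w (Nq : N q) := derive2_linear_dir w oN Nq (conj dg C1g).
have e'0 : 0 < e / n.+1%:R ^+ 2 by rewrite divr_gt0// exprn_gt0.
have : \forall q \near p0, N q /\ forall i j,
    `|'D_(b i) ('D_(b j) g) p0 - 'D_(b i) ('D_(b j) g) q| <= e / n.+1%:R ^+ 2.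
  apply: filterI; first exact: open_nbhs_nbhs.
  apply: filter_forall => i; apply: filter_forall => j.
  by move/cvgrPdist_le : (cDDg (b i) (b j) p0 Np0); exact.
move=> /nbhs_ballP[d /= d0 Hd]; exists d => // p w pd pwd.
have Nseg (r : R) : 0 <= r <= 1 -> N (p + r *: L w).
  by move=> r01; apply: (Hd _ _).1; rewrite -ball_normE; exact: ball_segment.
have Np : N p by apply: (Hd p _).1; rewrite -ball_normE.
split=> //; set K := 'D_(L w) _ p0 - _.
have KD (r : R) : 0 <= r <= 1 -> K <= 'D_(L w) ('D_(L w) g) (p + r *: L w).
  move=> r01; set q := p + _; have Nq : N q by exact: Nseg.
  have qd : `|p0 - q| < d by exact: ball_segment.
  rewrite /K !DDE// lerBlDr -lerBlDl -sumrB.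
  under eq_bigr do rewrite -sumrB.
  rewrite (le_trans (ler_norm _))// (le_trans (ler_norm_sum _ _ _))//.
  apply: (@le_trans _ _
    (\sum_(i < n) \sum_(j < n) `|w| * `|w| * (e / n.+1%:R ^+ 2))).
    apply: ler_sum => i _; rewrite (le_trans (ler_norm_sum _ _ _))//.
    apply: ler_sum => j _; rewrite -mulrBr !normrM.
    rewrite ler_pM ?mulr_ge0 ?ler_pM ?mx_entry_le//.
    by apply: (Hd q _).2; rewrite -ball_normE.
  rewrite !sumr_const !card_ord -mulrnA -[leLHS]mulr_natr -expr2 -mulrA.
  rewrite [leLHS]mulrC ler_wpM2r ?sqr_ge0// mulrAC ler_pdivrMr ?exprn_gt0//.
  by rewrite ler_pM2l// -natrX ler_nat -mulnn leq_mul.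
pose phi r := g (p + r *: L w).
pose psi (r : R) : R := 'D_(L w) g (p + r *: L w).
have psi_ge (r : R) : 0 <= r <= 1 -> psi 0 + K * r <= psi r.
  move=> /andP[r0 r1].
  have sub s : 0 <= s <= r -> 0 <= s <= 1.
    by move=> /andP[-> sr]; exact: le_trans r1.
  have [||s] := @MVT_segment R psi
    (fun s => 'D_(L w) ('D_(L w) g) (p + s *: L w)) 0 r r0.
  - move=> s; rewrite in_itv/= => /andP[/ltW s0 /ltW sr]; apply: is_derive_line.
    by apply/diff_derivable/dDg/Nseg/sub; rewrite s0.
  - apply: (@is_derive_line_continuous V R ('D_(L w) g) p (L w) 0 r) => s s0r.
    by apply/diff_derivable/dDg/Nseg/sub.
  rewrite in_itv/= subr0 => s0r E.
  rewrite -lerBrDl E ler_wpM2r//; exact/KD/sub.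
(* chi is phi minus its lower Taylor parabola; its derivative is nonnegative *)
pose chi r := phi r - (psi 0 * r + K / 2 * r ^+ 2).
have [||s] := @MVT_segment R chi (fun r => psi r - (psi 0 + K * r)) 0 1 ler01.
- move=> r; rewrite in_itv/= => /andP[/ltW r0 /ltW r1].
  have dphi : is_derive r 1 phi (psi r).
    by apply/is_derive_line/diff_derivable/dg/Nseg; rewrite r0.
  rewrite /chi; apply: is_derive_eq.
  by rewrite /GRing.scale/=; field.
- have : {within `[0, 1], continuous phi}.
    apply: (@is_derive_line_continuous V R g p (L w) 0 1) => s s01.
    by apply/diff_derivable/dg/Nseg.
  have cq : continuous (fun r : R => psi 0 * r + K / 2 * r ^+ 2).
    move=> r; apply: cvgD.
      by apply: cvgM; [exact: cvg_cst|exact: cvg_id].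
    by apply: cvgM; [exact: cvg_cst|exact: exprn_continuous].
  move=> cphi r; apply: cvgB; first exact: cphi.
  exact: (continuous_subspaceT cq).
rewrite in_itv/= => s01; rewrite subr0 mulr1 /chi /phi /psi.
rewrite !scale0r scale1r !addr0 !expr0n/= expr1n !mulr0 !mulr1 addr0 subr0 => E.
have := psi_ge s s01; rewrite /psi scale0r addr0; move: E; lra.
Qed.

End Directions.

Lemma derive_at_min (V : normedModType R) (g : V -> R) (p v : V) :
  derivable g p v -> (forall q, g p <= g q) -> 'D_v g p = 0.
Proof.
move=> dg gmin.
have dr := cvg_dnbhs_at_right dg; have dl := cvg_dnbhs_at_left dg.
apply/eqP; rewrite eq_le; apply/andP; split.
- apply: (cvgr_to_le dl); near=> h.
  have h0 : h < 0 by near: h; exact: nbhs_left_lt.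
  rewrite /GRing.scale/= nmulr_rle0 ?invr_lt0// subr_ge0; exact: gmin.
- apply: (cvgr_to_ge dr); near=> h.
  have h0 : 0 < h by near: h; exact: nbhs_right_gt.
  rewrite /GRing.scale/= pmulr_rge0 ?invr_gt0// subr_ge0; exact: gmin.
Unshelve. all: by end_near. Qed.

End Calculus.

(** * Integrals over segments and piecewise C^1 paths *)

Section IntegralsOnSegments.
Context {R : realType}.
Notation mu := (@lebesgue_measure R).
Implicit Types (f g : R -> R) (a b c : R).

(** End points are negligible. This matters because [derive1 c] is the velocity
    of a C^1 arc c in the open interval only. *)
Lemma eq_open_itv_integrable f g a b : (forall x, a < x < b -> f x = g x) ->
  mu.-integrable `[a, b] (EFin \o g) -> mu.-integrable `[a, b] (EFin \o f).
Proof.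
move=> fg /integrableP[mg ig].
have mf : measurable_fun `]a, b[ f.
  apply: (eq_measurable_fun g); first by move=> x; rewrite inE/= in_itv/= => xab; rewrite fg.
  have /measurable_EFinP := mg; apply: measurable_funS => //.
  exact: subset_itv_oo_cc.
have mcf := measurable_fun_itv_cc mf.
apply/integrableP; split; first exact/measurable_EFinP.
have mabs (h : R -> R) : measurable_fun `]a, b[ h ->
    measurable_fun `]a, b[ (fun x => `|(h x)%:E|%E).
  by move=> mh; apply: measurableT_comp => //; exact/measurable_EFinP.
rewrite integral_itv_bndoo//; last exact: mabs.
move: ig; rewrite integral_itv_bndoo//; last first.
  apply: mabs; apply: (eq_measurable_fun f) mf => x.
  by rewrite inE/= in_itv/= => xab; rewrite fg.
by congr (_ < _)%E; apply: eq_integral => x; rewrite inE/= in_itv/= => xab; rewrite fg.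
Qed.

Lemma eq_open_itv_Rintegral f g a b : (forall x, a < x < b -> f x = g x) ->
  mu.-integrable `[a, b] (EFin \o g) ->
  \int[mu]_(x in `[a, b]) f x = \int[mu]_(x in `[a, b]) g x.
Proof.
move=> fg ig; have /integrableP[/measurable_EFinP mf _] :=
  eq_open_itv_integrable fg ig.
have /integrableP[/measurable_EFinP mg _] := ig.
have [sf sg] : measurable_fun `]a, b[ f /\ measurable_fun `]a, b[ g.
  split; [move: mf|move: mg]; apply: measurable_funS => //;
    exact: subset_itv_oo_cc.
rewrite /Rintegral; congr (fine _); apply: eq_integral_itv_bounded => //.
Qed.

Lemma itv_cat_integrable f a b c : a <= b -> b <= c ->
  mu.-integrable `[a, b] (EFin \o f) -> mu.-integrable `[b, c] (EFin \o f) ->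
  mu.-integrable `[a, c] (EFin \o f).
Proof.
move=> ab bc iab ibc.
have {ibc} ibc : mu.-integrable `]b, c] (EFin \o f).
  by apply: integrableS ibc => //; exact: subset_itv_oc_cc.
have -> : `[a, c]%classic = `[a, b] `|` `]b, c].
  by rewrite -itv_bndbnd_setU.
have /integrableP[mab fab] := iab; have /integrableP[mbc fbc] := ibc.
have mU : measurable_fun (`[a, b] `|` `]b, c]) (EFin \o f).
  by apply/measurable_funU.
apply/integrableP; split => //.
rewrite ge0_integral_setU//.
- by rewrite lte_add_pinfty.
- by apply: measurableT_comp.
- apply/disj_setPS => y [/=]; rewrite !in_itv/= => /andP[_ yb] /andP[].
  by rewrite ltNge yb.
Qed.

Lemma itv_cat_Rintegral f a b c : a <= b -> b <= c ->
  mu.-integrable `[a, b] (EFin \o f) -> mu.-integrable `[b, c] (EFin \o f) ->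
  \int[mu]_(x in `[a, c]) f x =
  \int[mu]_(x in `[a, b]) f x + \int[mu]_(x in `[b, c]) f x.
Proof.
move=> ab bc iab ibc; have iac := itv_cat_integrable ab bc iab ibc.
have := @Rintegral_itvB R f (BLeft a) (BRight c) b iac.
rewrite !bnd_simp ab bc => /(_ isT isT).
rewrite Rintegral_itv_obnd_cbnd => [<-|]; first by rewrite addrC subrK.
by apply: integrableS ibc => //; exact: subset_itv_oc_cc.
Qed.

End IntegralsOnSegments.

Section QformLimits.
Context {R : realType} {n : nat}.

Lemma cvg_sumr (V : normedModType R) (T I : Type) (F : set_system T)
    {FF : Filter F} (r : seq I) (f : I -> T -> V) (l : I -> V) :
  (forall i, f i x @[x --> F] --> l i) ->
  \sum_(i <- r) f i x @[x --> F] --> \sum_(i <- r) l i.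
Proof.
move=> fl; elim: r => [|i r IH].
  by rewrite big_nil; under eq_fun do rewrite big_nil; exact: cvg_cst.
rewrite big_cons; under eq_fun do rewrite big_cons.
exact: cvgD.
Qed.

Lemma cvg_mx_entry (T : Type) (F : set_system T) {FF : Filter F} m k
    (M : T -> 'M[R]_(m, k)) (A : 'M[R]_(m, k)) i j :
  M x @[x --> F] --> A -> M x i j @[x --> F] --> A i j.
Proof.
move=> MA; apply: (cvg_comp _ (fun N : 'M[R]_(m, k) => N i j) MA).
exact: coord_continuous.
Qed.

Lemma cvg_bil (T : Type) (F : set_system T) {FF : Filter F}
    (Q : T -> 'M[R]_n) (u v : T -> 'rV[R]_n) (A : 'M[R]_n) (w z : 'rV[R]_n) :
  Q x @[x --> F] --> A -> u x @[x --> F] --> w -> v x @[x --> F] --> z ->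
  bil (Q x) (u x) (v x) @[x --> F] --> bil A w z.
Proof.
move=> QA uw vz; rewrite bilE; under eq_fun do rewrite bilE.
apply: (@cvg_sumr R^o) => j; apply: (@cvg_sumr R^o) => i.
by apply: cvgM; [apply: cvgM|]; exact: cvg_mx_entry.
Qed.

Lemma cvg_qnorm (T : Type) (F : set_system T) {FF : Filter F}
    (Q : T -> 'M[R]_n) (u : T -> 'rV[R]_n) (A : 'M[R]_n) (w : 'rV[R]_n) :
  Q x @[x --> F] --> A -> u x @[x --> F] --> w ->
  qnorm (Q x) (u x) @[x --> F] --> qnorm A w.
Proof.
move=> QA uw; apply: (cvg_comp (fun x => bil (Q x) (u x) (u x)) Num.sqrt).
  exact: (cvg_bil QA uw uw).
exact: sqrt_continuous.
Qed.

End QformLimits.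

Section Paths.
Context {R : realType} {n : nat}.
Implicit Types (c : R -> 'rV[R]_n) (a b d s t : R) (p q : seq R).

Lemma has_derivative_in_continuous (V : normedModType R) (A : set R)
    (g : R -> V) s (l : V) :
  has_derivative_in A g s l -> g t @[t --> within A (nbhs s)] --> g s.
Proof.
move=> gl.
have d0 : t - s @[t --> within A s^'] --> 0.
  rewrite -[X in _ --> X](subrr s); apply: cvgB; last exact: cvg_cst.
  by apply: cvg_within_filter; apply: cvg_within_filter; exact: cvg_id.
have h : (t - s) *: ((t - s)^-1 *: (g t - g s)) + g s @[t --> within A s^'] -->
    0 *: l + g s by apply: cvgD; [exact: cvgZ|exact: cvg_cst].
have {h} h : g t @[t --> within A s^'] --> g s.
  rewrite -[X in _ --> X]add0r -(scale0r l).
  apply: cvg_trans h; apply: near_eq_cvg; rewrite near_withinE.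
  near=> t => At.
  have ts : t - s != 0 by rewrite subr_eq0; near: t; exact: nbhs_dnbhs_neq.
  by rewrite /= scalerA divff// scale1r subrK.
move=> B gB; have [e /= e0 eB] := h B gB.
exists e => // t te At; have [->|ts] := eqVneq t s; last exact: eB.
by rewrite /=; exact: nbhs_singleton gB.
Unshelve. all: by end_near. Qed.

Lemma has_derivative_in_derive1 (V : normedModType R) (A : set R)
    (g : R -> V) s (l : V) :
  nbhs s A -> has_derivative_in A g s l -> derive1 g s = l.
Proof.
move=> sA gl; rewrite /derive1; apply: cvg_lim => //.
move=> B /gl; rewrite /within/= => -[e /= e0 eB].
have [e' /= e'0 e'A] := sA.
exists (Num.min e e'); first by rewrite /= lt_min e0.
move=> h; rewrite /ball_/= sub0r normrN lt_min => /andP[he he'] h0.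
have := eB (h + s); rewrite /ball_/= opprD addrCA subrr addr0 normrN addrK.
apply=> //; first by rewrite -subr_eq0 addrK.
by apply: e'A; rewrite /ball_/= opprD addrCA subrr addr0 normrN.
Qed.

Lemma eq_has_derivative_in (V : normedModType R) (A : set R)
    (g1 g2 : R -> V) s (l : V) :
  A s -> (forall t, A t -> g1 t = g2 t) ->
  has_derivative_in A g1 s l -> has_derivative_in A g2 s l.
Proof.
move=> As E; apply: cvg_trans; apply: near_eq_cvg; rewrite near_withinE.
by near=> t => At; rewrite !E.
Unshelve. all: by end_near. Qed.

Lemma eq_C1_path a b c1 c2 :
  (forall s, a <= s <= b -> c1 s = c2 s) -> C1_path a b c1 -> C1_path a b c2.
Proof.
move=> E [dc [cdc dcE]]; exists dc; split=> // s sab.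
apply: (eq_has_derivative_in _ _ (dcE s sab)); first by rewrite /= in_itv.
by move=> t; rewrite /= in_itv/=; exact: E.
Qed.

(** Recursive form of the condition in [piecewise_C1_path], suited to induction
    and to juxtaposition. *)
Fixpoint pieces a p c : Prop :=
  if p is x :: p' then [/\ a < x, C1_path a x c & pieces x p' c] else True.

Lemma piecewise_C1_piecesP a b c :
  piecewise_C1_path a b c <-> exists2 p, pieces a p c & last a p = b.
Proof.
split=> [[p [ap /eqP lp] H]|[p]].
  exists p => //; elim: p a ap lp H => //= x p IH a /andP[ax xp] lp H.
  split=> //; first exact: (H 0%N).
  by apply: IH => // i ip; exact: (H i.+1).
move=> H lp; exists p.
  split; last exact/eqP.
  by elim: p a H {lp} => //= x p IH a [-> _ /IH].
elim: p a H lp => //= x p IH a [ax ac xp] lp [//|i] ip.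
exact: (IH x xp lp).
Qed.

Lemma pieces_cat a p q c :
  pieces a p c -> pieces (last a p) q c -> pieces a (p ++ q) c.
Proof. by elim: p a => //= x p IH a [ax ac xp] qc; split=> //; exact: IH. Qed.

Lemma pieces_le a p c : pieces a p c -> a <= last a p.
Proof.
elim: p a => //= x p IH a [/ltW ax _ /IH]; exact: le_trans.
Qed.

Lemma eq_pieces a p c1 c2 : (forall s, a <= s <= last a p -> c1 s = c2 s) ->
  pieces a p c1 -> pieces a p c2.
Proof.
elim: p a => //= x p IH a E [ax ac xp]; have xl := pieces_le xp.
split=> //.
  apply: eq_C1_path ac => s /andP[as_ sx]; apply: E; rewrite as_.
  exact: le_trans xl.
by apply: IH xp => s /andP[xs sl]; apply: E; rewrite sl (le_trans (ltW ax)).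
Qed.

Lemma piecewise_C1_le a b c : piecewise_C1_path a b c -> a <= b.
Proof. by move=> /piecewise_C1_piecesP[p /pieces_le + <-]. Qed.

Lemma piecewise_C1_ind c (Phi : R -> R -> Prop) :
  (forall a, Phi a a) ->
  (forall a b, a < b -> C1_path a b c -> Phi a b) ->
  (forall a b d, piecewise_C1_path a b c -> piecewise_C1_path b d c ->
     Phi a b -> Phi b d -> Phi a d) ->
  forall a b, piecewise_C1_path a b c -> Phi a b.
Proof.
move=> Phi0 Phi1 Phi2 a b /piecewise_C1_piecesP[p ap <-] {b}.
elim: p a ap => //= x p IH a [ax ac xp].
apply: (Phi2 a x); [| |exact: Phi1|exact: IH].
  by apply/piecewise_C1_piecesP; exists [:: x].
by apply/piecewise_C1_piecesP; exists p.
Qed.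

Definition cat_path b c1 c2 : R -> 'rV[R]_n :=
  fun s => if s <= b then c1 s else c2 s.

Lemma cat_pathr b d c1 c2 : c1 b = c2 b ->
  forall s, b <= s <= d -> c2 s = cat_path b c1 c2 s.
Proof.
move=> E s /andP[bs _]; rewrite /cat_path; case: leP => // sb.
by have -> : s = b by apply/eqP; rewrite eq_le sb.
Qed.

Lemma cat_path_piecewise a b d c1 c2 : c1 b = c2 b ->
  piecewise_C1_path a b c1 -> piecewise_C1_path b d c2 ->
  piecewise_C1_path a d (cat_path b c1 c2).
Proof.
move=> E /piecewise_C1_piecesP[p ap pb] /piecewise_C1_piecesP[q bq qd].
apply/piecewise_C1_piecesP; exists (p ++ q); last by rewrite last_cat pb.
apply: pieces_cat.
  by apply: eq_pieces ap => s /andP[_]; rewrite pb /cat_path => ->.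
by rewrite pb; apply: eq_pieces bq; exact: cat_pathr.
Qed.

Lemma segment_has_derivative_in (A : set R) a s (y w : 'rV[R]_n) :
  has_derivative_in A (fun s => y + (s - a) *: w) s w.
Proof.
rewrite /has_derivative_in; apply: cvg_near_cst.
rewrite near_withinE; near=> t => _.
have ts : t - s != 0 by rewrite subr_eq0; near: t; exact: nbhs_dnbhs_neq.
rewrite opprD addrACA subrr add0r -scalerBl opprB addrA subrK.
by rewrite scalerA mulVf// scale1r.
Unshelve. all: by end_near. Qed.

Lemma segment_C1_path a b (y w : 'rV[R]_n) :
  C1_path a b (fun s => y + (s - a) *: w).
Proof.
exists (fun=> w); split; first by apply: continuous_subspaceT => s; exact: cvg_cst.
by move=> s _; exact: segment_has_derivative_in.
Qed.

Lemma segment_piecewise a b (y w : 'rV[R]_n) : a < b ->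
  piecewise_C1_path a b (fun s => y + (s - a) *: w).
Proof.
move=> ab; apply/piecewise_C1_piecesP; exists [:: b] => //=.
by split=> //; exact: segment_C1_path.
Qed.

End Paths.

(** * Length of paths *)

Section Lengths.
Context {R : realType} {n : nat}.
Notation mu := (@lebesgue_measure R).
Implicit Types (c : R -> 'rV[R]_n) (a b d s t : R).

Lemma within_itv_left (T : nbhsType) (g : R -> T) a b t (l : T) : a < t <= b ->
  g x @[x --> within `[a, b] (nbhs t)] --> l -> g x @[x --> t^'-] --> l.
Proof.
move=> /andP[at_ tb] gl B /gl [e /= e0 eB].
exists (Num.min e (t - a)); first by rewrite /= lt_min e0 subr_gt0.
move=> x; rewrite /ball_/= lt_min => /andP[xe xa] xt.
apply: eB => //=; rewrite in_itv/= (le_trans (ltW xt) tb) andbT.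
by move: xa; rewrite gtr0_norm ?subr_gt0// ltrD2l ltrN2 => /ltW.
Qed.

Lemma has_derivative_in_itv_right (V : normedModType R) (g : R -> V) a b t
    (l : V) : a <= t < b ->
  has_derivative_in `[a, b] g t l -> right_derivative g t l.
Proof.
move=> /andP[at_ tb]; apply: has_derivative_in_right; near=> s.
rewrite /= in_itv/=; apply/andP; split.
  by rewrite (le_trans at_)//; near: s; exact: nbhs_right_ge.
by near: s; exact: nbhs_right_ltW.
Unshelve. all: by end_near. Qed.

Lemma integral_right_growth (k : R -> R) a b s e : a <= s < b ->
  mu.-integrable `[a, b] (EFin \o k) ->
  k x @[x --> within `[a, b] (nbhs s)] --> k s -> 0 < e ->
  \forall t \near s^'+, \int[mu]_(x in `[a, s]) k x + (t - s) * (k s - e)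
    <= \int[mu]_(x in `[a, t]) k x.
Proof.
move=> /andP[as_ sb] ik kc e0.
have /cvgrPdist_le/(_ e e0)[d /= d0 dk] := kc.
near=> t.
have st : s < t by near: t; exact: nbhs_right_gt.
have tb : t <= b by near: t; exact: nbhs_right_ltW.
have td : t - s < d by near: t; exact: nbhs_right_ltDr.
have sub u v : a <= u -> v <= b -> mu.-integrable `[u, v] (EFin \o k).
  move=> au vb; apply: integrableS ik => //.
  by apply: subset_itvScc; rewrite bnd_simp.
have ist : mu.-integrable `[s, t] (EFin \o k) by apply: sub.
rewrite (itv_cat_Rintegral as_ (ltW st))//; last first.
  by apply: sub => //; exact: ltW.
rewrite lerD2l.
have -> : (t - s) * (k s - e) = \int[mu]_(x in `[s, t]) (k s - e).
  rewrite Rintegral_cst//= lebesgue_measure_itv/= lte_fin st -EFinD/=.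
  by rewrite mulrC.
apply: le_Rintegral => //.
  apply: continuous_compact_integrable; first exact: segment_compact.
  by apply: continuous_subspaceT => x; exact: cvg_cst.
move=> x; rewrite /= in_itv/= => /andP[sx xt].
have : `|k s - k x| <= e.
  apply: dk; rewrite /=.
    rewrite distrC ger0_norm ?subr_ge0//.
    by rewrite (le_lt_trans _ td)// lerD2r.
  by rewrite in_itv/= (le_trans as_ sx) (le_trans xt tb).
by rewrite ler_norml => /andP[_]; lra.
Unshelve. all: by end_near. Qed.

Variable P : 'rV[R]_n -> 'M[R]_n.
Hypothesis Pc : continuous P.

Lemma C1_path_speed a b c dc :
  (forall s, a <= s <= b -> has_derivative_in `[a, b] c s (dc s)) ->
  forall s, a < s < b -> speed P c s = qnorm (P (c s)) (dc s).
Proof.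
move=> cd s /andP[as_ sb].
have sab : a <= s <= b by rewrite !ltW.
rewrite /speed (has_derivative_in_derive1 _ (cd s sab))//.
apply: (@filterS _ _ _ `]a, b[%classic); first exact: subset_itv_oo_cc.
by apply: near_in_itvoo; rewrite in_itv/= as_.
Qed.

Lemma C1_path_speed_continuous a b c dc :
  {within `[a, b], continuous dc} ->
  (forall s, a <= s <= b -> has_derivative_in `[a, b] c s (dc s)) ->
  {within `[a, b], continuous (fun s => qnorm (P (c s)) (dc s))}.
Proof.
move=> /subspace_continuousP cdc cd; apply/subspace_continuousP => s.
rewrite /= in_itv/= => sab; apply: cvg_qnorm; last first.
  by apply: cdc; rewrite /= in_itv.
apply: (cvg_comp _ P (has_derivative_in_continuous (cd s sab))); exact: Pc.
Qed.

Lemma speed_integrable a b c :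
  piecewise_C1_path a b c -> mu.-integrable `[a, b] (EFin \o speed P c).
Proof.
apply: (piecewise_C1_ind (Phi := fun a b =>
  mu.-integrable `[a, b] (EFin \o speed P c))) => {a b} [a|a b ab|a b d].
- rewrite set_itv1; apply: null_set_integrable => //.
    exact: measurable_fun_set1.
  exact: lebesgue_measure_set1.
- move=> [dc [cdc cd]]; apply: (eq_open_itv_integrable (C1_path_speed cd)).
  apply: continuous_compact_integrable; first exact: segment_compact.
  exact: C1_path_speed_continuous.
- move=> /piecewise_C1_le ab /piecewise_C1_le bd; exact: itv_cat_integrable.
Qed.

Lemma path_length_ge0 a b c : 0 <= path_length P a b c.
Proof. by apply: Rintegral_ge0 => s _; exact: sqrtr_ge0. Qed.

Lemma path_length_cat a b d c :
  piecewise_C1_path a b c -> piecewise_C1_path b d c ->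
  path_length P a d c = path_length P a b c + path_length P b d c.
Proof.
move=> ab bd; apply: itv_cat_Rintegral; [| |exact: speed_integrable|exact: speed_integrable].
- exact: piecewise_C1_le ab.
- exact: piecewise_C1_le bd.
Qed.

(** The increments of U are measured with the metric frozen at z, so that the
    rate of change of U along a path is at most the speed. Comparing the growth
    of U with that of the integral of the speed avoids differentiating U, which
    may have kinks. *)
Lemma lipschitz_path_length (U : 'rV[R]_n -> R) :
  (forall z z', U z' <= U z + qnorm (P z) (z' - z)) ->
  forall a b c, piecewise_C1_path a b c ->
    U (c b) - U (c a) <= path_length P a b c.
Proof.
move=> U1 a b c cab.
apply: (piecewise_C1_ind (Phi := fun a b =>
    U (c b) - U (c a) <= path_length P a b c)) cab => {a b} [a|a b ab cab|a b d ab bd].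
- by rewrite subrr path_length_ge0.
- have [dc [cdc cd]] := cab.
  pose k s := qnorm (P (c s)) (dc s).
  have kc : {within `[a, b], continuous k} by exact: C1_path_speed_continuous.
  have ik : mu.-integrable `[a, b] (EFin \o k).
    by apply: continuous_compact_integrable => //; exact: segment_compact.
  rewrite /path_length (eq_open_itv_Rintegral (C1_path_speed cd) ik).
  pose I s := \int[mu]_(x in `[a, s]) k x.
  rewrite -/(I b); apply/ler_addgt0Pr => e e0.
  have e1 : 0 < e / (2 * (b - a)) by rewrite divr_gt0// mulr_gt0// subr_gt0.
  set e' := e / _ in e1.
  have : U (c b) - I b <= U (c a) + 2 * e' * (b - a).
  apply: (@growth_le R (fun s => U (c s) - I s) a b (2 * e') (U (c a))).
  + by rewrite /I set_itv1 Rintegral_set1 subr0.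
  + move=> t tab; apply: cvgB.
      have ct : c x @[x --> t^'-] --> c t.
        apply: (within_itv_left tab); apply: has_derivative_in_continuous.
        by apply: cd; case/andP: tab => /ltW -> ->.
      have Pct : P (c x) @[x --> t^'-] --> P (c t).
        by apply: (cvg_comp _ P ct); exact: Pc.
      apply: (@squeeze_cvgr _ _ _ _
        (fun x => U (c t) - qnorm (P (c x)) (c t - c x))
        (fun x => U (c t) + qnorm (P (c t)) (c x - c t))).
      * near=> x; rewrite U1 andbT lerBlDr; exact: U1.
      * rewrite -[X in _ --> X]subr0; apply: cvgB; first exact: cvg_cst.
        rewrite -(qnorm0 (P (c t))) -(subrr (c t)).
        by apply: cvg_qnorm => //; apply: cvgB => //; exact: cvg_cst.
      * rewrite -[X in _ --> X]addr0; apply: cvgD; first exact: cvg_cst.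
        rewrite -(qnorm0 (P (c t))) -(subrr (c t)).
        apply: cvg_qnorm; first exact: cvg_cst.
        by apply: cvgB => //; exact: cvg_cst.
    apply: (within_itv_left tab).
    have /subspace_continuousP := parameterized_integral_continuous (ltW ab) ik.
    by apply; rewrite /= in_itv/=; case/andP: tab => /ltW -> ->.
  + move=> t tab _.
    have tab' : a <= t <= b by case/andP: tab => -> /ltW ->.
    have tI : t \in `[a, b] by rewrite inE/= in_itv.
    have kt : k x @[x --> within `[a, b] (nbhs t)] --> k t.
      by move/subspace_continuousP : kc; apply; rewrite /= in_itv.
    have ct := has_derivative_in_itv_right tab (cd t tab').
    have : qnorm (P (c t)) ((x - t)^-1 *: (c x - c t)) @[x --> t^'+] --> k t.
      by apply: cvg_qnorm; [exact: cvg_cst|exact: ct].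
    move=> /cvgrPdist_le/(_ e' e1) Hq.
    have HI := integral_right_growth tab ik kt e1.
    apply: filterS3 (nbhs_right_gt t) Hq HI => x tx qx Ix.
    have tx0 : 0 < x - t by rewrite subr_gt0.
    have : qnorm (P (c t)) (c x - c t) <= (x - t) * (k t + e').
      have -> : c x - c t = (x - t) *: ((x - t)^-1 *: (c x - c t)).
        by rewrite scalerA divff ?scale1r// gt_eqF.
      rewrite qnormZ gtr0_norm// ler_pM2l//.
      by move: qx; rewrite ler_norml => /andP[+ _]; lra.
    have := U1 (c t) (c x); move: Ix; rewrite -!/(I _) !mulrDr !mulrN.
    lra.
  + by rewrite (ltW ab) lexx.
  have -> : 2 * e' * (b - a) = e.
    by rewrite /e'; field; rewrite subr_eq0 gt_eqF.
  lra.
- by rewrite (path_length_cat ab bd); lra.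
Unshelve. all: by end_near. Qed.

Lemma eq_path_length a b c1 c2 : piecewise_C1_path a b c1 ->
  (forall s, a < s < b -> c1 s = c2 s) ->
  path_length P a b c2 = path_length P a b c1.
Proof.
move=> c1ab E; apply: eq_open_itv_Rintegral; last exact: speed_integrable.
move=> s sab; rewrite /speed -E//; congr (Num.sqrt (qform _ _)).
rewrite !derive1E; apply: near_eq_derive.
have : \forall t \near s, t \in `]a, b[%R by apply: near_in_itvoo; rewrite in_itv.
by apply: filterS => t; rewrite in_itv/= => /E.
Qed.

Lemma segment_length a b (y w : 'rV[R]_n) K : a < b ->
  (forall r, a <= r <= b -> qnorm (P (y + (r - a) *: w)) w <= K) ->
  path_length P a b (fun s => y + (s - a) *: w) <= K * (b - a).
Proof.
move=> ab HK; set c := fun s => _.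
have cab : piecewise_C1_path a b c by exact: segment_piecewise.
have spE s : speed P c s = qnorm (P (c s)) w.
  rewrite /speed; congr (Num.sqrt (qform _ _)).
  apply: (@has_derivative_in_derive1 _ _ setT); first exact: filterT.
  exact: segment_has_derivative_in.
have iK : mu.-integrable `[a, b] (EFin \o cst K).
  apply: continuous_compact_integrable; first exact: segment_compact.
  by apply: continuous_subspaceT => x; exact: cvg_cst.
have -> : K * (b - a) = \int[mu]_(x in `[a, b]) K.
  by rewrite Rintegral_cst//= lebesgue_measure_itv/= lte_fin ab -EFinD.
apply: le_Rintegral => //; first exact: speed_integrable.
by move=> s; rewrite /= in_itv/= spE; exact: HK.
Qed.

End Lengths.

(** * The Riemannian distance *)

Section Distance.
Context {R : realType} {n : nat}.
Implicit Types (c : R -> 'rV[R]_n) (a b d s t : R) (x y z w : 'rV[R]_n).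

Variable P : 'rV[R]_n -> 'M[R]_n.
Hypothesis Pc : continuous P.

Notation dist := (riemannian_dist P).

Lemma dist_le_path a b c : a < b -> piecewise_C1_path a b c ->
  dist (c a) (c b) <= path_length P a b c.
Proof.
move=> ab cab; apply: ge_inf; last by exists a, b, c.
by exists 0 => _ [a' [b' [c' [_ _ _ _ ->]]]]; exact: path_length_ge0.
Qed.

Lemma dist_le_segment y z K :
  (forall r, 0 <= r <= 1 -> qnorm (P (y + r *: (z - y))) (z - y) <= K) ->
  dist y z <= K.
Proof.
move=> HK; have := dist_le_path ltr01 (segment_piecewise y (z - y) ltr01).
rewrite !subr0 scale0r scale1r addr0 addrC subrK => /le_trans; apply.
have := @segment_length _ _ P Pc 0 1 y (z - y) K ltr01.
by rewrite subr0 mulr1; apply=> r r01; rewrite subr0; exact: HK.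
Qed.

Lemma dist_ge y z m :
  (forall a b c, a < b -> piecewise_C1_path a b c -> c a = y -> c b = z ->
     m <= path_length P a b c) -> m <= dist y z.
Proof.
move=> H; apply: lb_le_inf.
  exists (path_length P 0 1 (fun s => y + (s - 0) *: (z - y))).
  exists 0, 1, (fun s => y + (s - 0) *: (z - y)); split=> //.
  - exact: segment_piecewise.
  - by rewrite subrr scale0r addr0.
  - by rewrite subr0 scale1r addrC subrK.
by move=> _ [a [b [c [ab cab ca cb ->]]]]; exact: H.
Qed.

Lemma dist_ge0 y z : 0 <= dist y z.
Proof. by apply: dist_ge => *; exact: path_length_ge0. Qed.

Lemma distxx x : dist x x = 0.
Proof.
apply/eqP; rewrite eq_le dist_ge0 andbT; apply: dist_le_segment => r _.
by rewrite subrr qnorm0.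
Qed.

Lemma dist_ge_lipschitz (U : 'rV[R]_n -> R) y z :
  (forall z z', U z' <= U z + qnorm (P z) (z' - z)) -> U z - U y <= dist y z.
Proof.
move=> U1; apply: dist_ge => a b c ab cab <- <-.
exact: lipschitz_path_length.
Qed.

(** Every path from y to z is prolonged by a segment at each end. This special
    case of the triangle inequality is what the continuity of the distance
    rests on. *)
Lemma dist_le_cat_segment y y' z z' K K' :
  (forall r, 0 <= r <= 1 -> qnorm (P (y' + r *: (y - y'))) (y - y') <= K) ->
  (forall r, 0 <= r <= 1 -> qnorm (P (z + r *: (z' - z))) (z' - z) <= K') ->
  dist y' z' <= K + dist y z + K'.
Proof.
move=> HK HK'; rewrite addrAC -lerBlDl; apply: dist_ge => a b c ab cab ca cb.
have a1a : a - 1 < a by rewrite ltrBlDr ltrDl.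
have bb1 : b < b + 1 by rewrite ltrDl.
pose c1 s := y' + (s - (a - 1)) *: (y - y').
pose c2 s := z + (s - b) *: (z' - z).
have c1a : c1 a = c a by rewrite /c1 subKr scale1r addrC subrK ca.
have cb2 : c b = c2 b by rewrite /c2 subrr scale0r addr0 cb.
pose e := cat_path a c1 (cat_path b c c2).
have cc2 : piecewise_C1_path a (b + 1) (cat_path b c c2).
  by apply: cat_path_piecewise => //; exact: segment_piecewise.
have cca : cat_path b c c2 a = c a by rewrite /cat_path (ltW ab).
have p1 : piecewise_C1_path (a - 1) a c1 by exact: segment_piecewise.
have p2 : piecewise_C1_path b (b + 1) c2 by exact: segment_piecewise.
have pe : piecewise_C1_path (a - 1) (b + 1) e.
  by apply: cat_path_piecewise => //; rewrite c1a cca.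
have lt1 : a - 1 < b + 1 by exact: lt_trans a1a (lt_trans ab bb1).
have := dist_le_path lt1 pe.
have -> : e (a - 1) = y'.
  by rewrite /e /cat_path (ltW a1a) /c1 subrr scale0r addr0.
have -> : e (b + 1) = z'.
  rewrite /e /cat_path !ifF; first last.
  - by apply/negbTE; rewrite -ltNge (lt_trans ab).
  - by apply/negbTE; rewrite -ltNge.
  by rewrite /c2 addrAC subrr add0r scale1r addrC subrK.
have E1 s : a - 1 <= s <= a -> c1 s = e s.
  by move=> /andP[_ sa]; rewrite /e /cat_path sa.
have E2 s : a <= s <= b + 1 -> cat_path b c c2 s = e s.
  by apply: cat_pathr; rewrite c1a cca.
have E3 s : a <= s <= b -> c s = cat_path b c c2 s.
  by move=> /andP[_ sb]; rewrite /cat_path sb.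
have E4 s : b <= s <= b + 1 -> c2 s = cat_path b c c2 s by exact: cat_pathr.
have sub (u v : R) g g' : (forall s, u <= s <= v -> g s = g' s) ->
    piecewise_C1_path u v g ->
    piecewise_C1_path u v g' /\ path_length P u v g' = path_length P u v g.
  move=> E pg; split.
    move: pg => /piecewise_C1_piecesP[p gp pv].
    apply/piecewise_C1_piecesP; exists p => //.
    by apply: eq_pieces gp; rewrite pv.
  by apply: eq_path_length => // s /andP[/ltW us /ltW sv]; apply: E; rewrite us.
have [q1 l1] := sub _ _ _ _ E1 p1.
have [q2 l2] := sub _ _ _ _ E2 cc2.
have [q3 l3] := sub _ _ _ _ E3 cab.
have [q4 l4] := sub _ _ _ _ E4 p2.
rewrite (path_length_cat Pc q1 q2) l1 l2 (path_length_cat Pc q3 q4) l3 l4.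
have L1 : path_length P (a - 1) a c1 <= K.
  have := @segment_length _ _ P Pc (a - 1) a y' (y - y') K a1a.
  rewrite subKr mulr1; apply => r /andP[r0 r1].
  by apply: HK; rewrite subr_ge0 r0 lerBlDr addrC subrK.
have L2 : path_length P b (b + 1) c2 <= K'.
  have := @segment_length _ _ P Pc b (b + 1) z (z' - z) K' bb1.
  rewrite addrAC subrr add0r mulr1; apply => r /andP[r0 r1].
  by apply: HK'; rewrite subr_ge0 r0 lerBlDl.
rewrite lerBlDl => /le_trans; apply.
move: L1 L2; clear; move: (path_length _ _ _ c1) (path_length _ _ _ c2).
by move=> l1 l2 L1 L2; rewrite addrCA addrC lerD2r lerD.
Qed.

Lemma qnorm_locally_bounded x : exists2 K, 0 < K & exists2 d, 0 < d &
  forall y w, `|x - y| < d -> qnorm (P y) w <= K * `|w|.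
Proof.
have PS : \forall y \near x, `|P x - P y| <= 1.
  by have /cvgrPdist_le := Pc (x := x); apply.
move: PS => /nbhs_ballP[d /= d0 Hd].
pose K := Num.sqrt (n%:R ^+ 2 * (`|P x| + 1)) + 1.
exists K; first by rewrite ltr_wpDl// sqrtr_ge0.
exists d => // y w yd.
have Py : `|P y| <= `|P x| + 1.
  rewrite -[X in `|X| <= _](subrK (P x)) addrC (le_trans (ler_normD _ _))//.
  by rewrite lerD2l distrC; apply: Hd; rewrite -ball_normE.
rewrite (@le_trans _ _ (Num.sqrt (n%:R ^+ 2 * (`|P x| + 1)) * `|w|))//; last first.
  by rewrite ler_wpM2r// lerDl.
have -> : `|w| = Num.sqrt (`|w| ^+ 2) by rewrite sqrtr_sqr normr_id.
rewrite -sqrtrM ?mulr_ge0// ?addr_ge0//.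
apply: ler_wsqrtr; rewrite (le_trans (ler_norm _))// (le_trans (qform_le _ _))//.
by rewrite ler_wpM2r ?sqr_ge0// ler_wpM2l.
Qed.

Lemma dist_locally_lipschitz x : exists2 K, 0 < K & exists2 d, 0 < d &
  forall y z, `|x - y| < d -> `|x - z| < d ->
    forall r, 0 <= r <= 1 ->
    qnorm (P (y + r *: (z - y))) (z - y) <= K * `|z - y|.
Proof.
have [K K0 [d d0 H]] := qnorm_locally_bounded x.
exists K => //; exists d => // y z yd zd r r01; apply: H.
by apply: ball_segment => //; rewrite (addrC y) subrK.
Qed.

Lemma cvg_dist (T : Type) (F : set_system T) {FF : Filter F}
    (Y Z : T -> 'rV[R]_n) y z :
  Y t @[t --> F] --> y -> Z t @[t --> F] --> z ->
  dist (Y t) (Z t) @[t --> F] --> dist y z.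
Proof.
move=> Yy Zz.
have [K K0 [d d0 H]] := dist_locally_lipschitz y.
have [K' K'0 [d' d'0 H']] := dist_locally_lipschitz z.
apply/cvgrPdist_le => e e0.
have e1 : 0 < e / (2 * K) by rewrite divr_gt0// mulr_gt0.
have e1' : 0 < e / (2 * K') by rewrite divr_gt0// mulr_gt0.
near=> t.
have Yd : `|y - Y t| < d by near: t; move/cvgrPdist_lt : Yy; exact.
have Zd : `|z - Z t| < d' by near: t; move/cvgrPdist_lt : Zz; exact.
have Ye : `|y - Y t| <= e / (2 * K) by near: t; move/cvgrPdist_le : Yy; exact.
have Ze : `|z - Z t| <= e / (2 * K') by near: t; move/cvgrPdist_le : Zz; exact.
have yd : `|y - y| < d by rewrite subrr normr0.
have zd : `|z - z| < d' by rewrite subrr normr0.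
have {}Ye : K * `|y - Y t| <= e / 2.
  rewrite (le_trans (ler_wpM2l (ltW K0) Ye))// le_eqVlt; apply/orP; left.
  by apply/eqP; field; rewrite gt_eqF.
have {}Ze : K' * `|z - Z t| <= e / 2.
  rewrite (le_trans (ler_wpM2l (ltW K'0) Ze))// le_eqVlt; apply/orP; left.
  by apply/eqP; field; rewrite gt_eqF.
have D1 := dist_le_cat_segment (H _ _ Yd yd) (H' _ _ zd Zd).
have D2 := dist_le_cat_segment (H _ _ yd Yd) (H' _ _ Zd zd).
rewrite ler_norml.
move: D1 D2; rewrite (distrC (Y t)) (distrC (Z t)); lra.
Unshelve. all: by end_near. Qed.

Hypothesis Pm : riemannian_metric P.
Let Psym x : (P x)^T = P x. Proof. by case: (Pm x). Qed.
Let Ppos x : pos_def (P x). Proof. by case: (Pm x). Qed.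

Hypothesis dP : forall x, differentiable P x.
Hypothesis cDP : forall x i, {for x, continuous ('D_(delta_mx 0 i) P)}.

(** Near x the metric is Lipschitz, being of class C^1, and uniformly equivalent
    to the norm, being positive definite at x. *)
Lemma metric_locally_comparable x : exists2 K, 0 < K & exists2 d, 0 < d &
  forall y z, `|x - y| < d -> `|x - z| < d -> forall w,
    [/\ `|qform (P z) w - qform (P y) w| <= K * `|z - y| * `|w| ^+ 2,
        `|w| ^+ 2 <= K * qform (P y) w & qform (P y) w <= K * `|w| ^+ 2].
Proof.
have [M M0 [d1 d10 H1]] :=
  @locally_lipschitz _ _ _ [the {linear 'rV[R]_n -> 'rV[R]_n} of idfun]
    _ _ P x dP (@cDP x).
have [c c0 Hc] := pos_def_coercive (Psym x) (Ppos x).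
have [k k0 [d2 d20 H2]] := qnorm_locally_bounded x.
pose N := (n%:R ^+ 2 + 1) * M.
have N0 : 0 < N by rewrite mulr_gt0// ltr_wpDl// sqr_ge0.
have lip y z w : `|x - y| < d1 -> `|x - z| < d1 ->
    `|qform (P z) w - qform (P y) w| <= N * `|z - y| * `|w| ^+ 2.
  move=> yd zd.
  have -> : qform (P z) w - qform (P y) w = qform (P z - P y) w.
    by apply/eqP; rewrite subr_eq -qformD subrK.
  rewrite (le_trans (qform_le _ _))// ler_wpM2r ?sqr_ge0//.
  have := H1 y (z - y) yd; rewrite /= (addrC y) subrK => /(_ zd) Hl.
  apply: (@le_trans _ _ (n%:R ^+ 2 * (M * `|z - y|))).
    by rewrite ler_wpM2l.
  by rewrite /N -mulrA ler_wpM2r ?mulr_ge0// ?ltW// ltrDl.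
pose d := Num.min (Num.min d1 d2) (c / (2 * N)).
have d0 : 0 < d by rewrite !lt_min d10 d20 divr_gt0// mulr_gt0.
pose K := N + 2 / c + k ^+ 2.
have K0 : 0 < K.
  by rewrite ltr_pwDl// ?sqr_ge0// addr_gt0// divr_gt0.
exists K => //; exists d => // y z; rewrite !lt_min.
move=> /andP[/andP[yd1 yd2] ydc] /andP[/andP[zd1 _] _] w.
have w0 : 0 <= `|w| ^+ 2 by rewrite sqr_ge0.
split.
- rewrite (le_trans (lip y z w yd1 zd1))// ler_wpM2r// ler_wpM2r//.
  by rewrite /K -addrA lerDl addr_ge0// ?sqr_ge0// ltW// divr_gt0.
- have xx : `|x - x| < d1 by rewrite subrr normr0.
  have := lip x y w xx yd1; rewrite ler_norml => /andP[+ _].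
  have := Hc w; rewrite (distrC y).
  have : N * `|x - y| * `|w| ^+ 2 <= c / 2 * `|w| ^+ 2.
    rewrite ler_wpM2r// -ler_pdivlMl// (le_trans (ltW ydc))// le_eqVlt.
    by apply/orP; left; apply/eqP; field; rewrite gt_eqF.
  move=> h1 h2 h3.
  have h : c / 2 * `|w| ^+ 2 <= qform (P y) w by lra.
  have q0 : 0 <= qform (P y) w by exact: qform_ge0.
  apply: (@le_trans _ _ (2 / c * qform (P y) w)).
    by rewrite -ler_pdivrMl ?divr_gt0// invf_div.
  rewrite ler_wpM2r// /K addrAC lerDr addr_ge0// ?sqr_ge0//; exact: ltW.
- rewrite -qnormK//.
  have : qnorm (P y) w ^+ 2 <= (k * `|w|) ^+ 2.
    by rewrite lerXn2r ?nnegrE ?mulr_ge0 ?qnorm_ge0 ?(ltW k0)// H2.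
  rewrite exprMn => /le_trans; apply.
  by rewrite ler_wpM2r// /K lerDr addr_ge0// ltW// divr_gt0.
Qed.

End Distance.

(** * The distance near the diagonal *)

Section DistanceNearDiagonal.
Context {R : realType} {n : nat}.
Implicit Types (x y z w : 'rV[R]_n).
Variable P : 'rV[R]_n -> 'M[R]_n.
Hypothesis Pc : continuous P.
Hypothesis Pm : riemannian_metric P.
Hypothesis dP : forall x, differentiable P x.
Hypothesis cDP : forall x i, {for x, continuous ('D_(delta_mx 0 i) P)}.

Let Psym x : (P x)^T = P x. Proof. by case: (Pm x). Qed.
Let Ppos x : pos_def (P x). Proof. by case: (Pm x). Qed.

Notation dist := (riemannian_dist P).

(** The lower bound must hold for all paths, including those that wander far
    away, where nothing is known about P. It is certified by the function
    [U z = (1 - max(0, 1 - C r)^2) / (2 C)] of [r = |z - y|_(P y)], which is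
    r - O(r^2) near y and constant as soon as r >= 1/C: its slope
    max(0, 1 - C r) is dominated by the metric near y and vanishes elsewhere. *)
Lemma dist_ge_near_diagonal x : exists2 C, 0 < C & exists2 d, 0 < d &
  forall y z, `|x - y| < d ->
    qnorm (P y) (z - y) - C / 2 * qform (P y) (z - y) <= dist y z.
Proof.
have [K K0 [d d0 H]] := metric_locally_comparable Pc Pm dP cDP x.
pose s := Num.sqrt K.
have s0 : 0 < s by rewrite sqrtr_gt0.
have sK : s ^+ 2 = K by rewrite sqr_sqrtr// ltW.
(* the first term confines the slope of U to the ball of radius d around x, the
   second absorbs the variation of P there *)
pose C := 2 * s / d + K ^+ 2 * s.
have C1 : 0 < 2 * s / d by rewrite divr_gt0// mulr_gt0.
have C2 : 0 < K ^+ 2 * s by rewrite mulr_gt0// exprn_gt0.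
have C0 : 0 < C by rewrite addr_gt0.
exists C => //; exists (d / 2); first by rewrite divr_gt0.
move=> y z yd2.
have yd : `|x - y| < d.
  by rewrite (lt_le_trans yd2)// ler_pdivrMr// ler_pMr// ler1n.
set Q := P y; pose r z := qnorm Q (z - y).
have r0 z' : 0 <= r z' by exact: qnorm_ge0.
have le_r z' : `|z' - y| <= s * r z'.
  rewrite -(ler_pXn2r (_ : 0 < 2)%N) ?nnegrE// ?mulr_ge0 ?qnorm_ge0 ?(ltW s0)//.
  rewrite exprMn sK qnormK; last exact: Ppos.
  by case: (H y y yd yd (z' - y)).
pose m z := Num.max 0 (1 - C * r z).
have m0 z' : 0 <= m z' by rewrite le_max lexx.
pose U z := (1 - m z ^+ 2) / (2 * C).
have C20 : 0 < 2 * C by rewrite mulr_gt0.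
have UE z' : U z' * (2 * C) = 1 - m z' ^+ 2 by rewrite divfK// gt_eqF.
have slope z1 u : m z1 * qnorm Q u <= qnorm (P z1) u.
  have [mz|mz] := leP (1 - C * r z1) 0.
    by rewrite /m (max_idPl mz) mul0r qnorm_ge0.
  have mE : m z1 = 1 - C * r z1 by rewrite /m (max_idPr (ltW mz)).
  have m1 : m z1 <= 1 by rewrite mE gerBl mulr_ge0// ltW.
  have z1d : `|x - z1| < d.
    have : `|z1 - y| < d / 2.
      have Cr : C * r z1 < 1 by rewrite -subr_gt0.
      have Cd : 1 <= C * (d / 2 / s).
        have -> : C * (d / 2 / s) = 1 + K ^+ 2 * s * (d / 2 / s).
          by rewrite /C mulrDl; congr (_ + _); field; rewrite !gt_eqF.
        rewrite lerDl; apply: mulr_ge0; first exact: ltW.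
        by rewrite !divr_ge0// ltW.
      have rd : r z1 < d / 2 / s by rewrite -(ltr_pM2l C0) (lt_le_trans Cr).
      by apply: (le_lt_trans (le_r z1)); rewrite mulrC -ltr_pdivlMr.
    move=> yz; have -> : x - z1 = (x - y) - (z1 - y).
      by rewrite opprB addrA subrK.
    rewrite (le_lt_trans (ler_normB _ _))// (splitr d); exact: ltrD.
  rewrite -(ler_pXn2r (_ : 0 < 2)%N) ?nnegrE ?mulr_ge0 ?qnorm_ge0//.
  rewrite exprMn !qnormK; [|exact: Ppos|exact: Ppos].
  have q0 : 0 <= qform Q u by apply: qform_ge0; exact: Ppos.
  apply: (@le_trans _ _ (m z1 * qform Q u)).
    by rewrite ler_wpM2r// expr2 ler_piMl.
  have [+ + _] := H y z1 yd z1d u; rewrite ler_norml => /andP[+ _] => h1 h2.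
  have h3 : K * `|z1 - y| * `|u| ^+ 2 <= K * (s * r z1) * (K * qform Q u).
    rewrite ler_pM ?mulr_ge0 ?sqr_ge0// ?(ltW K0)//.
    by rewrite ler_wpM2l// ltW.
  have h4 : K * (s * r z1) * (K * qform Q u) <= C * r z1 * qform Q u.
    have -> : K * (s * r z1) * (K * qform Q u) = K ^+ 2 * s * (r z1 * qform Q u).
      by ring.
    by rewrite -(mulrA C) ler_wpM2r ?mulr_ge0// /C lerDr ltW.
  by rewrite mE mulrBl mul1r; lra.
have U1 z1 z2 : U z2 <= U z1 + qnorm (P z1) (z2 - z1).
  apply: le_trans (_ : U z1 + m z1 * qnorm Q (z2 - z1) <= _); last first.
    by rewrite lerD2l.
  set q := qnorm Q _; have q0 : 0 <= q by exact: qnorm_ge0.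
  have r2 : r z2 <= r z1 + q.
    have := qnormD (z2 - z1) (z1 - y) (Psym y) (Ppos y).
    by rewrite addrA subrK => h; rewrite addrC; exact: h.
  have m2 : m z1 ^+ 2 - 2 * m z1 * (C * q) <= m z2 ^+ 2.
    have m2r : 1 - C * r z2 <= m z2 by rewrite le_max lexx orbT.
    have Cr2 : C * r z2 <= C * r z1 + C * q by rewrite -mulrDr ler_pM2l.
    have [mz|mz] := leP (1 - C * r z1) 0.
      have -> : m z1 = 0 by rewrite /m (max_idPl mz).
      by rewrite expr0n mulr0 mul0r subr0 sqr_ge0.
    have mE : m z1 = 1 - C * r z1 by rewrite /m (max_idPr (ltW mz)).
    have h : 0 <= m z2 - m z1 + C * q by move: mE Cr2 m2r; lra.
    have := mulr_ge0 (m0 z1) h; have := sqr_ge0 (m z2 - m z1).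
    by move: (m z1) (m z2) (C * q) => a b D; nra.
  rewrite -(ler_pM2r C20) [leRHS]mulrDl !UE.
  by move: m2; rewrite (_ : m z1 * q * (2 * C) = 2 * m z1 * (C * q)); [lra|ring].
have := dist_ge_lipschitz Pc y z U1; apply: le_trans.
have my : m y = 1.
  by rewrite /m /r subrr qnorm0 mulr0 subr0 (max_idPr _).
rewrite {2}/U my expr1n subrr mul0r subr0 -qnormK; last exact: Ppos.
rewrite -/(r z) -(ler_pM2r C20) UE.
have -> : (r z - C / 2 * r z ^+ 2) * (2 * C) = 1 - (1 - C * r z) ^+ 2 by field.
rewrite lerD2l lerN2 /m; have [h|h] := leP 0 (1 - C * r z).
  by [].
by rewrite expr0n sqr_ge0.
Qed.

(** For the upper bound, the length of the segment from y to z. *)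
Lemma dist_sqr_near_diagonal x : exists2 K, 0 < K & exists2 d, 0 < d &
  forall y z, `|x - y| < d -> `|x - z| < d ->
    `|dist y z ^+ 2 - qform (P y) (z - y)| <= K * `|z - y| ^+ 3.
Proof.
have [C C0 [d d0 L]] := dist_ge_near_diagonal x.
have [K K0 [d' d'0 H]] := metric_locally_comparable Pc Pm dP cDP x.
pose s := Num.sqrt K.
have s0 : 0 <= s by exact: sqrtr_ge0.
have sK : s ^+ 2 = K by rewrite sqr_sqrtr// ltW.
exists (C * (K * s) + K); first by rewrite ltr_wpDl// !mulr_ge0// ltW.
exists (Num.min d d'); first by rewrite lt_min d0.
move=> y z; rewrite !lt_min => /andP[yd yd'] /andP[zd zd'].
set w := z - y; set q := qform (P y) w; set p := qnorm (P y) w.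
have p0 : 0 <= p by exact: qnorm_ge0.
have pq : p ^+ 2 = q by apply: qnormK; exact: Ppos.
have ps : p <= s * `|w|.
  rewrite -(ler_pXn2r (_ : 0 < 2)%N) ?nnegrE ?mulr_ge0//.
  by rewrite exprMn sK pq; case: (H y z yd' zd' w).
have w0 : 0 <= `|w| by [].
have D0 : 0 <= dist y z by exact: dist_ge0.
rewrite ler_norml; apply/andP; split.
- have p3 : p ^+ 3 <= K * s * `|w| ^+ 3.
    have -> : K * s * `|w| ^+ 3 = (s * `|w|) ^+ 3 by rewrite -sK; ring.
    by rewrite lerXn2r ?nnegrE ?mulr_ge0.
  have low : q - C * p ^+ 3 <= dist y z ^+ 2.
    have := L y z yd; rewrite -/w -/p -/q -pq => Lp.
    have [h|h] := leP (p - C / 2 * p ^+ 2) 0.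
      apply: le_trans (sqr_ge0 _).
      have : p * (p - C / 2 * p ^+ 2) <= 0 by rewrite mulr_ge0_le0.
      have : 0 <= C * p ^+ 3 by rewrite mulr_ge0 ?exprn_ge0// ltW.
      have := sqr_ge0 p; rewrite mulrBr; nra.
    have : (p - C / 2 * p ^+ 2) ^+ 2 <= dist y z ^+ 2.
      by rewrite lerXn2r ?nnegrE// ltW.
    apply: le_trans; rewrite sqrrB.
    have -> : p * (C / 2 * p ^+ 2) *+ 2 = C * p ^+ 3.
      by rewrite -[LHS]mulr_natl; field.
    by rewrite lerDl sqr_ge0.
  have : 0 <= K * `|w| ^+ 3 by rewrite mulr_ge0 ?exprn_ge0// ltW.
  have : C * p ^+ 3 <= C * (K * s * `|w| ^+ 3) by rewrite ler_pM2l.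
  by move: low; rewrite (mulrDl (C * _)) -(mulrA C); lra.
- have B0 : 0 <= q + K * `|w| ^+ 3.
    by rewrite addr_ge0 ?mulr_ge0 ?exprn_ge0 ?(ltW K0)// -pq sqr_ge0.
  have : dist y z <= Num.sqrt (q + K * `|w| ^+ 3).
    apply: (dist_le_segment Pc) => t /andP[t0 t1]; apply: ler_wsqrtr.
    have td : `|x - (y + t *: w)| < d'.
      by apply: ball_segment => //; rewrite ?t0// /w (addrC y) subrK.
    have [+ _ _] := H y _ yd' td w; rewrite ler_norml => /andP[_].
    rewrite addrAC subrr add0r normrZ ger0_norm// -/w -/q.
    have : K * (t * `|w|) * `|w| ^+ 2 <= K * `|w| ^+ 3.
      rewrite exprS [leRHS]mulrA ler_wpM2r ?sqr_ge0// ler_wpM2l ?(ltW K0)//.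
      by rewrite ler_piMl.
    lra.
  move=> /(lerXn2r 2); rewrite !nnegrE D0 sqrtr_ge0 => /(_ isT isT).
  rewrite sqr_sqrtr//.
  have : 0 <= C * (K * s) * `|w| ^+ 3.
    by rewrite !mulr_ge0 ?exprn_ge0 ?(ltW K0) ?(ltW C0).
  by rewrite (mulrDl (C * _)); lra.
Qed.

Lemma norm_le_dist x : exists2 K, 0 < K & exists2 d, 0 < d &
  forall y z, `|x - y| < d -> `|x - z| < d ->
    `|z - y| ^+ 2 <= K * dist y z ^+ 2.
Proof.
have [K K0 [d d0 H]] := metric_locally_comparable Pc Pm dP cDP x.
have [K' K'0 [d' d'0 H']] := dist_sqr_near_diagonal x.
have e0 : 0 < (4 * K * K')^-1 by rewrite invr_gt0 !mulr_gt0.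
exists (2 * K); first by rewrite mulr_gt0.
exists (Num.min (Num.min d d') (4 * K * K')^-1); first by rewrite !lt_min d0 d'0.
move=> y z; rewrite !lt_min => /andP[/andP[y1 y2] y3] /andP[/andP[z1 z2] z3].
have [_ + _] := H y z y1 z1 (z - y).
have := H' y z y2 z2; rewrite ler_norml => /andP[+ _].
set w := `|z - y|; set q := qform _ _; set D := dist y z ^+ 2 => h1 h2.
have w2 : 2 * K * K' * w <= 1.
  have : w <= 2 * (4 * K * K')^-1.
    have -> : w = `|(x - y) - (x - z)|.
      by rewrite /w opprB [in RHS]addrC addrA subrK.
    rewrite (le_trans (ler_normB _ _))// mulr_natl mulr2n lerD// ltW//.
  have k0 : 0 < 2 * K * K' by rewrite !mulr_gt0.
  move=> wl; apply: (@le_trans _ _ (2 * K * K' * (2 * (4 * K * K')^-1))).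
    by rewrite ler_pM2l.
  by rewrite le_eqVlt; apply/orP; left; apply/eqP; field; rewrite !gt_eqF.
have h3 : K * q <= K * D + K * (K' * w ^+ 3).
  by rewrite -mulrDr ler_pM2l//; move: h1; lra.
have h4 : 2 * (K * (K' * w ^+ 3)) <= w ^+ 2.
  have -> : 2 * (K * (K' * w ^+ 3)) = 2 * K * K' * w * w ^+ 2 by ring.
  by rewrite ler_piMl// sqr_ge0.
by move: h2 h3 h4; lra.
Qed.

End DistanceNearDiagonal.

(** * First-order expansion of the interconnected system *)

Section Perturbation.
Context {R : realType} {n m : nat}.
Implicit Types (x y z v w : 'rV[R]_n).

Definition first_arg (w : 'rV[R]_n) : 'rV[R]_n * 'rV[R]_m := (w, 0).

Lemma first_arg_linear : linear first_arg.
Proof.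
move=> a u w; rewrite /first_arg.
have -> : a *: (u, 0 : 'rV[R]_m) + (w, 0) = (a *: u + w, a *: 0 + 0) by [].
by rewrite scaler0 addr0.
Qed.

HB.instance Definition _ := GRing.isLinear.Build R 'rV[R]_n
  ('rV[R]_n * 'rV[R]_m)%type *:%R first_arg first_arg_linear.

Variables (f : 'rV[R]_n -> 'rV[R]_n) (h : 'rV[R]_n -> 'rV[R]_m)
  (F : 'rV[R]_n * 'rV[R]_m -> 'rV[R]_n).

Section OneSolution.
Variables (xh x : 'rV[R]_n) (Xh X : R -> 'rV[R]_n).
Hypothesis sol : solution_from f h F xh x Xh X.

Lemma halfline_right (t : R) : 0 <= t ->
  \forall s \near t^'+, `[0, +oo[%classic s.
Proof.
move=> t0; near=> s; rewrite /= in_itv/= andbT; apply: (le_trans t0).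
by near: s; exact: nbhs_right_ge.
Unshelve. all: by end_near. Qed.

Lemma halfline_left (t : R) : 0 < t ->
  \forall s \near t^'-, `[0, +oo[%classic s.
Proof.
move=> t0; near=> s; rewrite /= in_itv/= andbT.
by near: s; exact: nbhs_left_ge.
Unshelve. all: by end_near. Qed.

Lemma solution_right t : 0 <= t -> right_derivative X t (f (X t)) /\
  right_derivative Xh t (F (Xh t, h (X t))).
Proof.
case: sol => _ _ H t0; have [dX dXh] := H t t0.
by split; apply: has_derivative_in_right; [exact: halfline_right| |
  exact: halfline_right|].
Qed.

Lemma solution_left t : 0 < t -> left_continuous X t /\ left_continuous Xh t.
Proof.
case: sol => _ _ H t0; have [dX dXh] := H t (ltW t0).
by split; [apply: has_derivative_in_left dX|apply: has_derivative_in_left dXh];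
  exact: halfline_left.
Qed.

Lemma solution_shift t0 : 0 <= t0 ->
  solution_from f h F (Xh t0) (X t0)
    (fun t => Xh (t0 + t)) (fun t => X (t0 + t)).
Proof.
move=> t00; case: sol => _ _ H; split; rewrite ?addr0// => t tge0.
have sh (V : normedModType R) (g : R -> V) l :
    has_derivative_in `[0, +oo[ g (t0 + t) l ->
    has_derivative_in `[0, +oo[ (fun s => g (t0 + s)) t l.
  move=> gl B /gl [e /= e0 eB]; exists e => // s st sA sn.
  have E u u' : t0 + u - (t0 + u') = u - u'.
    by rewrite opprD addrACA subrr add0r.
  have := eB (t0 + s); rewrite /ball_/= !E; apply=> //.
    by rewrite (inj_eq (addrI _)).
  by move: sn; rewrite /= !in_itv/= !andbT => s0; rewrite addr_ge0.
by have [dX dXh] := H (t0 + t) (addr_ge0 t00 tge0); split; apply: sh.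
Qed.

End OneSolution.

Lemma right_derivative_continuous (V : normedModType R) (g : R -> V) t l :
  right_derivative g t l -> g s @[s --> t^'+] --> g t.
Proof.
move=> gl; apply/cvgrPdist_le => e e0.
have H1 := right_derivative_near gl ltr01.
have b0 : 0 < e / (`|l| + 1) by rewrite divr_gt0// ltr_wpDl.
near=> s.
have st : 0 < s - t by rewrite subr_gt0; near: s; exact: nbhs_right_gt.
have sd : s - t < e / (`|l| + 1) by near: s; exact: nbhs_right_ltDr.
have : `|g s - g t - (s - t) *: l| <= 1 * (s - t) by near: s; exact: H1.
rewrite mul1r => Hs; rewrite distrC.
rewrite -(subrK ((s - t) *: l) (g s - g t)) (le_trans (ler_normD _ _))//.
rewrite normrZ gtr0_norm//.
move: sd; rewrite ltr_pdivlMr ?ltr_wpDl// => sd; move: Hs; lra.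
Unshelve. all: by end_near. Qed.

Hypothesis f_cont : continuous f.
Hypothesis h_cont : continuous h.
Hypothesis F_diff : forall p, differentiable F p.
Hypothesis F_C1 : forall u p : 'rV[R]_n * 'rV[R]_m,
  {for p, continuous ('D_u F)}.
Hypothesis drift : forall x, F (x, h x) = f x.

(** The expansion is uniform in the size [s] of the initial error [s v]. It comes
    from successive trapping arguments: both components stay in a ball where f
    and F are bounded; there the error E satisfies |E'| <= C |E|, hence remains
    comparable with s; and by strict differentiability of F, E' is close to
    s A v, where A is the derivative of F in its first argument. *)
Lemma flow_expansion x v e : 0 < e -> exists2 d, 0 < d &
  forall s t Xh X, 0 < s <= d -> 0 <= t <= d ->
    solution_from f h F (x + s *: v) x Xh X ->
    `|X t - (x + t *: f x)| <= e * t /\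
    `|Xh t - X t - s *: (v + t *: 'D_(first_arg v) F (x, h x))| <= e * s * t.
Proof.
move=> e0; set p0 := (x, h x); pose D w := 'D_(first_arg w) F p0.
have DE w : D w = \sum_i w 0 i *: D (delta_mx 0 i).
  exact: (derive_linear_dir first_arg).
pose K := \sum_i `|D (delta_mx 0 i)|.
have K0 : 0 <= K by rewrite sumr_ge0.
have DK w : `|D w| <= K * `|w|.
  rewrite DE (le_trans (ler_norm_sum _ _ _))// mulr_suml; apply: ler_sum => i _.
  by rewrite normrZ mulrC ler_wpM2l// mx_entry_le.
have DB u w : D (u - w) = D u - D w.
  by rewrite /D !deriveE// linearB /= linearB.
have DZ a w : D (a *: w) = a *: D w.
  by rewrite /D !deriveE// linearZ /= linearZ.
(* N s will bound the error and M2 s its rate of change *)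
pose N := 2 * `|v| + 1.
have N0 : 0 < N by rewrite ltr_wpDl// mulr_ge0.
have e1 : 0 < Num.min 1 (e / (4 * N)) by rewrite lt_min ltr01 divr_gt0// mulr_gt0.
set e' := Num.min _ _ in e1.
have e'1 : e' <= 1 by rewrite ge_min lexx.
have e'N : e' * N <= e / 4.
  apply: (@le_trans _ _ (e / (4 * N) * N)).
    by rewrite ler_wpM2r ?(ltW N0)// ge_min lexx orbT.
  by rewrite le_eqVlt; apply/orP; left; apply/eqP; field; rewrite gt_eqF.
have [d1 d10 SD] := @strict_differentiability _ _ _
  [the {linear 'rV[R]_n -> _} of first_arg] _ _ F p0 F_diff
  (fun i => @F_C1 _ p0) e' e1.
pose M := `|f x| + `|F p0| + e + 1.
have M0 : 0 < M by rewrite ltr_wpDl// !addr_ge0// ltW.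
have [r r0 Hr] : exists2 r, 0 < r & forall y z, `|x - y| < r -> `|x - z| < r ->
    [/\ `|f y - f x| < e, `|f y| < M, `|F (z, h y)| < M &
        `|p0 - (z, h y)| < d1].
  have fe : \forall y \near x, `|f x - f y| < e.
    by have /cvgrPdist_lt := f_cont (x := x); apply.
  have pe d : 0 < d -> \forall yz \near (x, x), `|p0 - (yz.2, h yz.1)| < d.
    move=> d0.
    have pc : (fun yz : 'rV[R]_n * 'rV[R]_n => (yz.2, h yz.1)) @ (x, x) --> p0.
      have c2 : snd @ nbhs (x, x) --> x by exact: cvg_snd.
      have c1 : h yz.1 @[yz --> (x, x)] --> h x.
        by apply: (cvg_comp fst h); [exact: cvg_fst|exact: h_cont].
      exact: (cvg_pair c2 c1).
    by move/cvgrPdist_lt : pc; apply.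
  have Fe : \forall p \near p0, `|F p0 - F p| < 1.
    have /cvgrPdist_lt := differentiable_continuous (F_diff p0).
    by apply.
  move: fe Fe => /nbhs_ballP[r1 /= r10 H1] /nbhs_ballP[r2 /= r20 H2].
  have r3 : 0 < Num.min d1 r2 by rewrite lt_min d10.
  have /nbhs_ballP[r4 /= r40 H4] := pe _ r3.
  exists (Num.min r1 r4); first by rewrite lt_min r10.
  move=> y z; rewrite !lt_min => /andP[y1 y4] /andP[z1 z4].
  have fy : `|f x - f y| < e by apply: H1; rewrite -ball_normE.
  have := H4 (y, z); rewrite lt_min => /(_ _)/andP[].
    by split; rewrite /= -ball_normE.
  move=> p1 p2.
  have Fz : `|F p0 - F (z, h y)| < 1 by apply: H2; rewrite -ball_normE.
  split=> //; first by rewrite distrC.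
  - rewrite -(subrK (f x) (f y)) (le_lt_trans (ler_normD _ _))//.
    by rewrite distrC /M; have := normr_ge0 (F p0); move: fy; lra.
  - rewrite -(subrK (F p0) (F _)) (le_lt_trans (ler_normD _ _))//.
    by rewrite distrC /M; have := normr_ge0 (f x); move: Fz e0; lra.
pose M2 := (K + 1) * N + 1.
have M20 : 0 < M2 by rewrite ltr_wpDl// mulr_ge0 ?addr_ge0// ltW.
pose d := Num.min (Num.min (r / 2 / M) (r / 4 / (`|v| + 1)))
  (Num.min ((`|v| + 1) / M2) (e / (4 * (K * M2 + 1)))).
have v1 : 0 < `|v| + 1 by rewrite ltr_wpDl.
have KM : 0 < K * M2 + 1 by rewrite ltr_wpDl// mulr_ge0// ltW.
exists d.
  by rewrite !lt_min !divr_gt0// mulr_gt0.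
move=> s t Xh X /andP[s0 sd] /andP[t0 td] sol.
have [X0 Xh0 _] := sol.
have dM : M * d <= r / 2.
  by rewrite mulrC -ler_pdivlMr// !ge_min lexx.
have dv : d * `|v| <= r / 4.
  apply: (@le_trans _ _ (d * (`|v| + 1))).
    by rewrite ler_wpM2l ?lerDl// (le_trans t0).
  by rewrite -ler_pdivlMr// !ge_min lexx !orbT.
have dM2 : M2 * d <= `|v| + 1.
  by rewrite mulrC -ler_pdivlMr// !ge_min lexx !orbT.
have dK : K * M2 * d <= e / 4.
  apply: (@le_trans _ _ ((K * M2 + 1) * d)).
    by rewrite ler_wpM2r ?lerDl// (le_trans t0).
  rewrite mulrC -ler_pdivlMr//.
  by rewrite -[X in _ <= X]mulrA -invfM !ge_min lexx !orbT.
have tt : 0 <= t <= t by rewrite t0 lexx.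
have sub u : 0 <= u < t -> 0 <= u <= t by move=> /andP[-> /ltW].
have ud u : 0 <= u <= t -> u <= d by move=> /andP[_ ut]; exact: le_trans td.
have solr u : 0 <= u < t -> right_derivative X u (f (X u)) /\
    right_derivative Xh u (F (Xh u, h (X u))).
  by move=> /andP[u0 _]; exact: solution_right sol _ u0.
have soll u : 0 < u <= t -> left_continuous X u /\ left_continuous Xh u.
  by move=> /andP[u0 _]; exact: solution_left sol _ u0.
have Mt : M * (t - 0) <= r / 2.
  by rewrite subr0 (le_trans _ dM)// ler_pM2l.
have r2r : r / 2 < r by rewrite ltr_pdivrMr// ltr_pMr// ltr1n.
have XB u : 0 <= u <= t -> `|x - X u| < r.
  move=> ut; rewrite distrC -X0; apply: (le_lt_trans _ r2r).
  apply: (le_trans (trapped_curve (ltW M0) Mt _ _ _ ut)).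
  - by move=> w /soll[].
  - by move=> w /solr[+ _]; exact.
  - move=> w _; rewrite X0 distrC => H1; have wr := le_lt_trans H1 r2r.
    by have [] := Hr (X w) (X w) wr wr.
  apply: le_trans Mt; rewrite subr0 ler_pM2l// subr0; by case/andP: ut.
have XhB u : 0 <= u <= t -> `|x - Xh u| < r.
  have start u' : `|Xh u' - Xh 0| <= r / 2 -> `|x - Xh u'| < r.
    move=> Hw; rewrite distrC.
    have -> : Xh u' - x = (Xh u' - Xh 0) + s *: v.
      by rewrite Xh0 opprD addrA subrK.
    rewrite (le_lt_trans (ler_normD _ _))// normrZ gtr0_norm//.
    have : s * `|v| <= d * `|v| by rewrite ler_wpM2r.
    move: Hw dv r0; lra.
  move=> ut; apply: (start u).
  apply: (le_trans (trapped_curve (ltW M0) Mt _ _ _ ut)).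
  - by move=> w /soll[].
  - by move=> w /solr[_ +]; exact.
  - move=> w wt /start wr.
    by have [] := Hr (X w) (Xh w) (XB w (sub w wt)) wr.
  apply: le_trans Mt; rewrite subr0 ler_pM2l// subr0; by case/andP: ut.
split.
  have -> : X t - (x + t *: f x) = (X t - t *: f x) - (X 0 - 0 *: f x).
    by rewrite scale0r subr0 X0 opprD addrA addrAC.
  have := @trapped_curve R _ (fun u => X u - u *: f x) (fun u => f (X u) - f x)
    0 t e (e * (t - 0)) (ltW e0) (lexx _) _ _ _ t tt.
  rewrite subr0; apply.
  - move=> u ut; apply: cvgB; first exact: (soll u ut).1.
    by apply: cvgZr_tmp; exact: cvg_id_left.
  - move=> u ut; apply: right_derivativeD; first exact: (solr u ut).1.
    by apply: right_derivativeN; exact: right_derivative_linear.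
  - move=> u /sub ut _; have Xu := XB u ut.
    by have [] := Hr (X u) (X u) Xu Xu.
pose E u := Xh u - X u.
have E0 : E 0 = s *: v by rewrite /E Xh0 X0 addrAC subrr add0r.
have Er u : 0 <= u < t ->
    right_derivative E u (F (Xh u, h (X u)) - F (X u, h (X u))).
  move=> ut; rewrite drift; apply: right_derivativeD; first exact: (solr u ut).2.
  by apply: right_derivativeN; exact: (solr u ut).1.
have El u : 0 < u <= t -> left_continuous E u.
  by move=> ut; apply: cvgB; [exact: (soll u ut).2|exact: (soll u ut).1].
have SDE u : 0 <= u <= t ->
    `|F (Xh u, h (X u)) - F (X u, h (X u)) - D (E u)| <= e' * `|E u|.
  move=> ut.
  have := SD (X u, h (X u)) (E u).
  have -> : (X u, h (X u)) + first_arg (E u) = (Xh u, h (X u)).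
    by congr pair; rewrite /= ?addr0// /E addrC subrK.
  apply.
  - by have [] := Hr (X u) (X u) (XB u ut) (XB u ut).
  - by have [] := Hr (X u) (Xh u) (XB u ut) (XhB u ut).
have NE u : `|E u - E 0| <= s * (`|v| + 1) -> `|E u| <= s * N.
  move=> Hu; rewrite -(subrK (E 0) (E u)) (le_trans (ler_normD _ _))//.
  rewrite {2}E0 normrZ gtr0_norm// /N; move: Hu; lra.
have sM2 : s * M2 * (t - 0) <= s * (`|v| + 1).
  rewrite subr0 -mulrA ler_pM2l// (le_trans _ dM2)// ler_pM2l//.
have E1 u : 0 <= u <= t -> `|E u - E 0| <= s * M2 * (u - 0).
  move=> ut; apply: (trapped_curve _ sM2 El Er _ ut).
    by rewrite mulr_ge0// ltW.
  move=> w /sub wt /NE EwN.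
  have := SDE w wt; set A := F _ - F _ => HA.
  rewrite -(subrK (D (E w)) A) (le_lt_trans (ler_normD _ _))//.
  have h1 : `|D (E w)| <= K * (s * N) by rewrite (le_trans (DK _))// ler_wpM2l.
  have h2 : e' * `|E w| <= 1 * (s * N) by rewrite ler_pM// ltW.
  have h3 : s * M2 = K * (s * N) + 1 * (s * N) + s by rewrite /M2; ring.
  move: HA h1 h2 s0; rewrite h3; lra.
have EN u : 0 <= u <= t -> `|E u| <= s * N.
  move=> ut; apply: NE; apply: (le_trans (E1 u ut)); apply: le_trans sM2.
  rewrite ler_pM2l ?mulr_gt0// lerD2r; by case/andP: ut.
have -> : Xh t - X t - s *: (v + t *: D v) =
    (E t - t *: (s *: D v)) - (E 0 - 0 *: (s *: D v)).
  rewrite scale0r subr0 E0 scalerDr opprD addrA addrAC -!addrA; congr (_ + _).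
  by rewrite !scalerA mulrC addrC.
have := @trapped_curve R _ (fun u => E u - u *: (s *: D v))
  (fun u => F (Xh u, h (X u)) - F (X u, h (X u)) - s *: D v)
  0 t (e * s) (e * s * (t - 0)) _ (lexx _) _ _ _ t tt.
rewrite subr0; apply.
- by rewrite mulr_ge0// ltW.
- move=> u ut; apply: cvgB; first exact: El.
  by apply: cvgZr_tmp; exact: cvg_id_left.
- move=> u ut; apply: right_derivativeD; first exact: Er.
  by apply: right_derivativeN; exact: right_derivative_linear.
move=> u /sub ut _; have := SDE u ut; set A := F _ - F _ => HA.
have -> : A - s *: D v = (A - D (E u)) + D (E u - E 0).
  by rewrite (DB (E u)) E0 DZ addrA subrK.
rewrite (le_lt_trans (ler_normD _ _))//.
have h1 : `|D (E u - E 0)| <= K * (s * M2 * d).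
  rewrite (le_trans (DK _))// ler_wpM2l// (le_trans (E1 u ut))//.
  by rewrite subr0 ler_pM2l ?mulr_gt0// ud.
have h2 : e' * `|E u| <= e' * (s * N) by rewrite ler_wpM2l ?(ltW e1)// EN.
have h3 : e' * (s * N) <= s * (e / 4) by rewrite mulrCA ler_pM2l.
have h4 : K * (s * M2 * d) <= s * (e / 4).
  have -> : K * (s * M2 * d) = s * (K * M2 * d) by ring.
  by rewrite ler_pM2l.
have h5 : 0 < e * s by rewrite mulr_gt0.
move: HA h1 h2 h3 h4 h5; lra.
Qed.

End Perturbation.

(** * Decrease of the distance along solutions *)

Section InfinitesimalContraction.
Context {R : realType} {n m : nat}.
Implicit Types (x y z v w : 'rV[R]_n).

Lemma limf_esup_le (T : choiceType) (X : filteredType T) (q : X -> R)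
    (F : set_system X) {FF : Filter F} (r e : R) :
  (limf_esup (fun t => (q t)%:E) F <= r%:E)%E -> 0 < e ->
  \forall t \near F, q t <= r + e.
Proof.
move=> qr e0.
have : (limf_esup (fun t => (q t)%:E) F < (r + e)%:E)%E.
  by rewrite (le_lt_trans qr)// lte_fin ltrDl.
rewrite limf_esupE => /ereal_inf_lt[_ [V FV <-]] Vr.
apply: filterS FV => t Vt; rewrite -lee_fin; apply/ltW/(le_lt_trans _ Vr).
by apply: ereal_sup_ubound; exists t.
Qed.

(** Dini derivatives are multiplied by the limit 2 u(t) of u(s) + u(t). *)
Lemma sqr_right_growth (u : R -> R) t (r c : R) :
  (forall s, 0 <= u s) -> u s @[s --> t^'+] --> u t ->
  (forall e, 0 < e -> \forall s \near t^'+, u s - u t <= (r + e) * (s - t)) ->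
  2 * u t * r < c ->
  \forall s \near t^'+, u s ^+ 2 <= u t ^+ 2 + c * (s - t).
Proof.
move=> u0 uc ud rc.
pose e := (c - 2 * u t * r) / (2 * (2 * u t + 1)).
have ut1 : 0 < 2 * u t + 1 by rewrite ltr_wpDl// mulr_ge0.
have e0 : 0 < e by rewrite divr_gt0 ?subr_gt0// mulr_gt0.
have lim : (r + e) * (u s + u t) @[s --> t^'+] --> (r + e) * (u t + u t).
  by apply: cvgM; [exact: cvg_cst|apply: cvgD => //; exact: cvg_cst].
have ltc : (r + e) * (u t + u t) < c.
  have : e * (2 * (2 * u t + 1)) = c - 2 * u t * r.
    by rewrite divfK// gt_eqF// mulr_gt0.
  by move: e0 (u0 t); nra.
have Hc : \forall s \near t^'+, (r + e) * (u s + u t) < c.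
  exact: (cvgr_lt _ lim).
apply: filterS3 (nbhs_right_gt t) (ud _ e0) Hc => s ts us cs.
have st : 0 < s - t by rewrite subr_gt0.
rewrite -lerBlDl subr_sqr.
apply: (@le_trans _ _ ((r + e) * (s - t) * (u s + u t))).
  by rewrite ler_wpM2r// addr_ge0.
by rewrite mulrAC ler_pM2r// ltW.
Qed.

(** The chain rule along the curve x + W t, differentiable from the right at 0. *)
Lemma cvg_difference_quotient (g : 'rV[R]_n -> 'M[R]_n) x l (W : R -> 'rV[R]_n) :
  (forall q, differentiable g q) ->
  (forall i, {for x, continuous ('D_(delta_mx 0 i) g)}) ->
  t^-1 *: W t @[t --> 0^'+] --> l ->
  t^-1 *: (g (x + W t) - g x) @[t --> 0^'+] --> 'D_l g x.
Proof.
move=> dg cg Wl.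
have DE w : 'D_w g x = \sum_i w 0 i *: 'D_(delta_mx 0 i) g x.
  exact: (derive_linear_dir [the {linear 'rV[R]_n -> 'rV[R]_n} of idfun]).
have c1 : 'D_(t^-1 *: W t) g x @[t --> 0^'+] --> 'D_l g x.
  rewrite DE; under eq_fun do rewrite DE.
  apply: cvg_sumr => i; apply: cvgZ; last exact: cvg_cst.
  by apply: cvg_mx_entry; exact: Wl.
have W0 : W t @[t --> 0^'+] --> (0 : 'rV[R]_n).
  have : t *: (t^-1 *: W t) @[t --> 0^'+] --> (0 : R) *: l.
    apply: cvgZ => //; apply: cvg_at_right_filter; exact: cvg_id.
  rewrite scale0r; apply: cvg_trans; apply: near_eq_cvg; near=> t.
  by rewrite scalerA divff ?scale1r// gt_eqF//; near: t; exact: nbhs_right_gt.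
rewrite -[X in _ --> X]subr0.
have -> : (fun t => t^-1 *: (g (x + W t) - g x)) = (fun t =>
    'D_(t^-1 *: W t) g x -
    ('D_(t^-1 *: W t) g x - t^-1 *: (g (x + W t) - g x))).
  by apply/funext => t; rewrite subKr.
apply: cvgB => //; apply/cvgrPdist_le => e e0.
pose k := `|l| + 1.
have k0 : 0 < k by rewrite ltr_wpDl.
have ek : 0 < e / k by rewrite divr_gt0.
have [d d0 SD] := @strict_differentiability _ _ _
  [the {linear 'rV[R]_n -> 'rV[R]_n} of idfun] _ _ g x dg cg _ ek.
have Wd : \forall t \near 0^'+, `|W t| < d.
  move/cvgrPdist_lt : W0 => /(_ d d0); apply: filterS => t.
  by rewrite sub0r normrN.
have Wk : \forall t \near 0^'+, `|t^-1 *: W t| <= k.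
  move/cvgrPdist_le : Wl => /(_ 1 ltr01); apply: filterS => t lt1.
  rewrite -(subrK l (t^-1 *: W t)) (le_trans (ler_normD _ _))// addrC lerD2l.
  by rewrite distrC.
apply: filterS3 (nbhs_right_gt 0) Wd Wk => t t0 wd wk.
rewrite sub0r normrN distrC.
have xx : `|x - x| < d by rewrite subrr normr0.
have := SD x (W t) xx; rewrite /= opprD addrA subrr add0r normrN => /(_ wd).
have -> : 'D_(W t) g x = t *: 'D_(t^-1 *: W t) g x.
  rewrite -[in LHS](scale1r (W t)) -(@divff _ t) ?gt_eqF// -scalerA.
  by rewrite !deriveE// linearZ.
move=> H; rewrite -(ler_pM2l t0) -[X in X * `|_|](gtr0_norm t0) -normrZ.
rewrite scalerBr scalerA divff ?gt_eqF// scale1r.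
apply: le_trans H _; have -> : W t = t *: (t^-1 *: W t).
  by rewrite scalerA divff ?scale1r// gt_eqF.
rewrite normrZ (gtr0_norm t0) mulrCA ler_pM2l//.
apply: (@le_trans _ _ (e / k * k)); first by rewrite ler_pM2l.
by rewrite divfK// gt_eqF.
Unshelve. all: by end_near. Qed.

Variables (f : 'rV[R]_n -> 'rV[R]_n) (h : 'rV[R]_n -> 'rV[R]_m)
  (F : 'rV[R]_n * 'rV[R]_m -> 'rV[R]_n) (P : 'rV[R]_n -> 'M[R]_n).
Hypothesis fwd : forward_complete f h F.
Hypothesis Pm : riemannian_metric P.
Hypothesis dP : forall x, differentiable P x.
Hypothesis cDP : forall x i, {for x, continuous ('D_(delta_mx 0 i) P)}.

Notation dist := (riemannian_dist P).

Let Pc : continuous P.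
Proof. by move=> x; exact: differentiable_continuous. Qed.

Lemma dini_along_solution xh x Xh X t r : solution_from f h F xh x Xh X ->
  0 <= t -> dini_dist_le f h F P (Xh t) (X t) r ->
  forall e, 0 < e -> \forall s \near t^'+,
    dist (Xh s) (X s) - dist (Xh t) (X t) <= (r + e) * (s - t).
Proof.
move=> sol t0 /(_ _ _ (solution_shift sol t0)) D e e0.
have H : \forall s \near 0^'+,
    (dist (Xh (t + s)) (X (t + s)) - dist (Xh t) (X t)) / s <= r + e.
  by apply: limf_esup_le e0; move: D; rewrite /dini_dist !addr0.
apply/nbhs_right0P; apply: filterS2 (nbhs_right_gt 0) H => s s0.
by rewrite ler_pdivrMr// addrAC subrr add0r.
Qed.

Lemma dist_solution_left xh x Xh X t : solution_from f h F xh x Xh X -> 0 < t ->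
  left_continuous (fun s => dist (Xh s) (X s)) t.
Proof. by move=> sol t0; have [? ?] := solution_left sol t0; exact: cvg_dist. Qed.

Lemma dist_solution_right xh x Xh X t : solution_from f h F xh x Xh X -> 0 <= t ->
  dist (Xh s) (X s) @[s --> t^'+] --> dist (Xh t) (X t).
Proof.
move=> sol t0; have [dX dXh] := solution_right sol t0.
by apply: cvg_dist => //; [exact: right_derivative_continuous dXh|
  exact: right_derivative_continuous dX].
Qed.

(** The distance vanishes at time 0 and its Dini derivative there is at most 0,
    hence it is o(t). It dominates the norm of the difference of the components,
    whose derivative f x - F (x, h x) at time 0 is therefore 0. *)
Lemma drift_eq x : dini_dist_le f h F P x x 0 -> F (x, h x) = f x.
Proof.
move=> D; have [Xh [X sol]] := fwd x x; have [X0 Xh0 _] := sol.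
have [K K0 [d d0 H]] := norm_le_dist Pc Pm dP cDP x.
have [dX dXh] := solution_right sol (lexx 0).
have dE := right_derivativeD dX (right_derivativeN dXh).
rewrite X0 Xh0 in dE; set l := f x - _ in dE.
apply/esym/eqP; rewrite -subr_eq0 -/l -normr_le0.
apply/ler_addgt0Pr => e e0; rewrite add0r.
pose a := e / Num.sqrt K.
have sK0 : 0 < Num.sqrt K by rewrite sqrtr_gt0.
have a0 : 0 < a by rewrite divr_gt0.
have D0 : dini_dist_le f h F P (Xh 0) (X 0) 0 by rewrite X0 Xh0.
have Da := dini_along_solution sol (lexx 0) D0 a0.
have near_x (Y : R -> 'rV[R]_n) l' : Y 0 = x -> right_derivative Y 0 l' ->
    \forall s \near 0^'+, `|x - Y s| < d.
  move=> Y0 /right_derivative_continuous; rewrite Y0 => /cvgrPdist_lt.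
  by apply.
have Nx := near_x X _ X0 dX.
have Nxh := near_x Xh _ Xh0 dXh.
apply: (cvgr_to_le (cvg_norm dE)).
near=> s; have s0 : 0 < s by near: s; exact: nbhs_right_gt.
have : dist (Xh s) (X s) - dist (Xh 0) (X 0) <= (0 + a) * (s - 0) by near: s; exact: Da.
rewrite X0 Xh0 (distxx Pc) add0r !subr0 => Ds.
have xs : `|x - X s| < d by near: s; exact: Nx.
have xhs : `|x - Xh s| < d by near: s; exact: Nxh.
rewrite subrr subr0 normrZ ger0_norm ?invr_ge0 ?(ltW s0)//.
rewrite ler_pdivrMl//.
have se0 : s * e \is Num.nneg by rewrite nnegrE mulr_ge0// ltW.
have as0 : a * s \is Num.nneg by rewrite nnegrE mulr_ge0// ltW.
have D_ge0 : dist (Xh s) (X s) \is Num.nneg by rewrite nnegrE dist_ge0.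
rewrite -(ler_pXn2r (_ : 0 < 2)%N)//; last by rewrite nnegrE.
apply: (le_trans (H _ _ xhs xs)).
have -> : (s * e) ^+ 2 = K * (a * s) ^+ 2.
  have K2 : K = Num.sqrt K ^+ 2 by rewrite sqr_sqrtr// ltW.
  rewrite [in RHS]K2 -exprMn /a; congr (_ ^+ _); field.
  by rewrite gt_eqF.
by rewrite ler_pM2l// lerXn2r.
Unshelve. all: by end_near. Qed.

End InfinitesimalContraction.

(** * The variational inequality *)

Section VariationalInequality.
Context {R : realType} {n m : nat}.
Implicit Types (x y z v w : 'rV[R]_n).
Variables (f : 'rV[R]_n -> 'rV[R]_n) (h : 'rV[R]_n -> 'rV[R]_m)
  (F : 'rV[R]_n * 'rV[R]_m -> 'rV[R]_n) (P : 'rV[R]_n -> 'M[R]_n).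
Hypothesis f_cont : continuous f.
Hypothesis h_cont : continuous h.
Hypothesis F_diff : forall p, differentiable F p.
Hypothesis F_C1 : forall u p : 'rV[R]_n * 'rV[R]_m,
  {for p, continuous ('D_u F)}.
Hypothesis drift : forall x, F (x, h x) = f x.
Hypothesis fwd : forward_complete f h F.
Hypothesis Pm : riemannian_metric P.
Hypothesis dP : forall x, differentiable P x.
Hypothesis cDP : forall x i, {for x, continuous ('D_(delta_mx 0 i) P)}.

Notation dist := (riemannian_dist P).

Let Pc : continuous P.
Proof. by move=> x; exact: differentiable_continuous. Qed.
Let Psym x : (P x)^T = P x. Proof. by case: (Pm x). Qed.
Let Ppos x : pos_def (P x). Proof. by case: (Pm x). Qed.

Variables (x v : 'rV[R]_n) (kappa : R).
Hypothesis kappa0 : 0 <= kappa.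
Hypothesis decay : exists2 d, 0 < d &
  forall z y, `|x - z| < d -> `|x - y| < d -> exists r : R,
    dini_dist_le f h F P z y (- r) /\
    kappa / 2 * qform (P x) (z - y) <= dist z y * r.

Let Av := 'D_(first_arg v) F (x, h x).

(** The solution started from the pair (x + t^2 v, x), observed at time t, so
    that the error made by replacing the distance with the quadratic form P,
    which is of relative size t^2, is negligible compared with t. *)
Lemma rescaled_dist_decrease (eta : R) : 0 < eta ->
  exists2 K, 0 <= K & exists2 d, 0 < d & forall t Xh X E, 0 < t <= d ->
    solution_from f h F (x + t ^+ 2 *: v) x Xh X ->
    E = (t ^+ 2)^-1 *: (Xh t - X t) ->
    qform (P (Xh t)) E - K * t ^+ 2 * `|E| ^+ 3 <=
    qform (P x) v + K * t ^+ 2 - t * (kappa * (qform (P x) v - eta) - eta).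
Proof.
move=> eta0; have [d0 d00 Hdec] := decay.
have [K1 K10 [d1 d10 H1]] := metric_locally_comparable Pc Pm dP cDP x.
have [K2 K20 [d2 d20 H2]] := dist_sqr_near_diagonal Pc Pm dP cDP x.
have [d3 d30 H3] := flow_expansion f_cont h_cont F_diff F_C1 drift x v ltr01.
have [e1 e10 H4] : exists2 e1, 0 < e1 & forall w, `|v - w| < e1 ->
    qform (P x) v - eta <= qform (P x) w.
  have : bil (P x) w w @[w --> v] --> bil (P x) v v.
    have c1 : (fun=> P x) w @[w --> v] --> P x.
      by apply: cvg_cst; exact: nbhs_filter.
    have c2 : w @[w --> v] --> v by exact: cvg_id.
    by apply: (cvg_bil c1 c2 c2); exact: nbhs_filter.
  move=> /cvgrPdist_le/(_ eta eta0)/nbhs_ballP[e1 /= e10 He].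
  exists e1 => // w vw; have := He w; rewrite -ball_normE => /(_ vw) /=.
  by rewrite ler_norml => /andP[_]; rewrite -!qform_bil; lra.
pose q := qform (P x); pose cc := kappa * (q v - eta) - eta.
exists ((K1 + K2) * `|v| ^+ 3 + K2).
  by rewrite addr_ge0 ?mulr_ge0 ?exprn_ge0 ?addr_ge0 ?(ltW K10) ?(ltW K20).
pose B := `|f x| + `|v| + `|Av| + 3.
have B0 : 0 < B by rewrite ltr_wpDl// !addr_ge0.
pose D := Num.min (Num.min d0 d1) (Num.min d2 e1).
have D0 : 0 < D by rewrite !lt_min d00 d10 d20.
exists (Num.min (Num.min 1 d3) (D / (2 * B))).
  by rewrite !lt_min ltr01 d30 divr_gt0// mulr_gt0.
move=> t Xh X E /andP[t0]; rewrite !le_min => /andP[/andP[t1 td3] tD] sol defE.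
set s := t ^+ 2 in sol defE *.
have [X0 Xh0 _] := sol.
have s0 : 0 < s by rewrite exprn_gt0.
have st : s <= t by rewrite /s expr2 ler_piMl// ltW.
clearbody s.
have tB : t * B < D.
  have : t * (2 * B) <= D by rewrite -ler_pdivlMr// mulr_gt0.
  have : 0 < t * B by rewrite mulr_gt0.
  lra.
have tE a : 0 <= a -> a <= B -> t * a < D.
  by move=> a0 aB; rewrite (le_lt_trans _ tB)// ler_pM2l.
(* along [0, t] the solution stays near x and the error near s v *)
have along u : 0 <= u <= t -> [/\ `|x - X u| < D, `|x - Xh u| < D &
    `|v - s^-1 *: (Xh u - X u)| < D].
  move=> /andP[u0 ut].
  have sd3 : 0 < s <= d3 by rewrite s0 (le_trans st td3).
  have ud3 : 0 <= u <= d3 by rewrite u0 (le_trans ut td3).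
  have [HX HE] := H3 s u Xh X sd3 ud3 sol.
  have HX1 : `|x - X u| <= u * (`|f x| + 1).
    have -> : x - X u = - (X u - (x + u *: f x)) - u *: f x.
      by rewrite opprB [RHS]addrAC addrK.
    rewrite (le_trans (ler_normB _ _))// normrN normrZ ger0_norm//.
    by rewrite mulrDr mulr1 addrC lerD2l; move: HX; rewrite mul1r.
  have dev : `|Xh u - X u - s *: v| <= s * (u * (`|Av| + 1)).
    have -> : Xh u - X u - s *: v =
        (Xh u - X u - s *: (v + u *: Av)) + s *: (u *: Av).
      by rewrite scalerDr opprD addrA subrK.
    rewrite (le_trans (ler_normD _ _))// !normrZ (gtr0_norm s0) (ger0_norm u0).
    by rewrite mulrDr mulrDr mulr1 addrC lerD2l; move: HE; rewrite mul1r.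
  have Gap : `|Xh u - X u| <= t * (`|v| + `|Av| + 1).
    rewrite -(subrK (s *: v) (Xh u - X u)) (le_trans (ler_normD _ _))//.
    rewrite normrZ gtr0_norm//.
    have sut : s * (u * (`|Av| + 1)) <= t * (`|Av| + 1).
      apply: ler_pM => //; [exact: ltW|by rewrite mulr_ge0// addr_ge0|].
      by rewrite ler_piMl ?addr_ge0// (le_trans ut).
    have sv : s * `|v| <= t * `|v| by rewrite ler_wpM2r.
    have := lerD (le_trans dev sut) sv => /le_trans; apply.
    by rewrite -mulrDr ler_pM2l// addrC addrA.
  have HXt : `|x - X u| <= t * (`|f x| + 1).
    by rewrite (le_trans HX1)// ler_wpM2r// addr_ge0.
  have n0 := normr_ge0 (f x); have n1 := normr_ge0 v; have n2 := normr_ge0 Av.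
  split.
  - by rewrite (le_lt_trans HXt)// tE// /B; lra.
  - have -> : x - Xh u = (x - X u) - (Xh u - X u).
      by rewrite opprB addrA subrK.
    rewrite (le_lt_trans (ler_normB _ _))//.
    rewrite (le_lt_trans (lerD HXt Gap))// -mulrDr tE// /B; lra.
  - have -> : v - s^-1 *: (Xh u - X u) = - (s^-1 *: (Xh u - X u - s *: v)).
      rewrite [in RHS]scalerBr [s^-1 *: (s *: v)]scalerA mulVf ?gt_eqF//.
      by rewrite scale1r opprB.
    rewrite normrN normrZ gtr0_norm ?invr_gt0// mulrC.
    rewrite (@le_lt_trans _ _ (t * (`|Av| + 1)))//; last by rewrite tE// /B; lra.
    rewrite ler_pdivrMr// mulrC (le_trans dev)// ler_pM2l//.
    by rewrite ler_wpM2r// addr_ge0.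
have Dle a : a < D -> [/\ a < d0, a < d1, a < d2 & a < e1].
  by rewrite !lt_min => /andP[/andP[-> ->] /andP[-> ->]].
pose u r := dist (Xh r) (X r).
have u0 r : 0 <= u r by exact: dist_ge0.
have tt : 0 <= t <= t by rewrite lexx ltW.
have decr : u t ^+ 2 <= u 0 ^+ 2 + (- (s ^+ 2 * cc)) * (t - 0).
  apply: (@growth_le R (fun r => u r ^+ 2) 0 t) => //.
    move=> r /andP[r0 _]; rewrite /left_continuous.
    have ur : u r' @[r' --> r^'-] --> u r by exact: dist_solution_left sol r0.
    by under eq_fun do rewrite expr2; rewrite expr2; exact: cvgM.
  move=> r rt _; have r0 : 0 <= r by case/andP: rt.
  have rt' : 0 <= r <= t by case/andP: rt => -> /ltW.
  have [/Dle[Xd0 _ _ _] /Dle[Xhd0 _ _ _] /Dle[_ _ _ Ee1]] := along r rt'.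
  have [rho [Drho Hrho]] := Hdec (Xh r) (X r) Xhd0 Xd0.
  apply: (@sqr_right_growth _ u r (- rho)) => //.
  - exact: dist_solution_right sol r0.
  - exact: dini_along_solution sol r0 Drho.
  have qE : s ^+ 2 * (q v - eta) <= q (Xh r - X r).
    have -> : q (Xh r - X r) = s ^+ 2 * q (s^-1 *: (Xh r - X r)).
      by rewrite -qformZ scalerA divff ?gt_eqF// scale1r.
    by rewrite ler_pM2l ?exprn_gt0//; exact: H4.
  have : kappa * (s ^+ 2 * (q v - eta)) <= kappa * q (Xh r - X r).
    by rewrite ler_wpM2l.
  have : 0 < s ^+ 2 * eta by rewrite mulr_gt0// exprn_gt0.
  have : kappa * q (Xh r - X r) <= 2 * (u r * rho).
    by move: Hrho; rewrite -/q -/(u r) mulrAC ler_pdivrMr// [leRHS]mulrC.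
  have -> : 2 * u r * - rho = - (2 * (u r * rho)) by ring.
  have -> : s ^+ 2 * cc = kappa * (s ^+ 2 * (q v - eta)) - s ^+ 2 * eta.
    by rewrite /cc; ring.
  lra.
have [/Dle[_ Xd1 Xd2 _] /Dle[_ Xhd1 Xhd2 _] _] := along t tt.
have t00 : 0 <= (0 : R) <= t by apply/andP; split => //; exact: ltW.
have [/Dle[_ Xd10 Xd20 _] /Dle[_ Xhd10 Xhd20 _] _] := along 0 t00.
have EE : Xh t - X t = s *: E by rewrite defE scalerA divff ?scale1r// gt_eqF.
have low : s ^+ 2 * qform (P (Xh t)) E - K2 * (s ^+ 3 * `|E| ^+ 3) <= u t ^+ 2.
  have := H2 (Xh t) (X t) Xhd2 Xd2; rewrite ler_norml => /andP[+ _].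
  rewrite -opprB qformN normrN EE qformZ normrZ gtr0_norm// exprMn -/(u t).
  lra.
have upp : u 0 ^+ 2 <= s ^+ 2 * q v + (K1 + K2) * (s ^+ 3 * `|v| ^+ 3).
  have := H2 (Xh 0) (X 0) Xhd20 Xd20; rewrite ler_norml -/(u 0) => /andP[_].
  have [+ _ _] := H1 (X 0) (Xh 0) Xd10 Xhd10 (s *: v).
  rewrite ler_norml => /andP[_].
  have -> : X 0 - Xh 0 = - (s *: v) by rewrite X0 Xh0 opprD addrA subrr sub0r.
  have -> : Xh 0 - X 0 = s *: v by rewrite X0 Xh0 addrAC subrr add0r.
  rewrite qformN normrN X0 !qformZ normrZ gtr0_norm// -/q !exprMn.
  have -> : K1 * (s * `|v|) * (s ^+ 2 * `|v| ^+ 2) = K1 * (s ^+ 3 * `|v| ^+ 3).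
    by ring.
  rewrite mulrDl; lra.
rewrite -/q -/cc.
rewrite -(ler_pM2l (_ : 0 < s ^+ 2)) ?exprn_gt0//.
have : 0 <= K2 * s ^+ 3 by rewrite mulr_ge0 ?exprn_ge0// ltW.
have : 0 <= (K1 + K2) * `|v| ^+ 3 * s ^+ 3 * `|E| ^+ 3.
  by rewrite !mulr_ge0 ?exprn_ge0 ?addr_ge0// ltW.
have : 0 <= K2 * s ^+ 3 * `|E| ^+ 3 by rewrite !mulr_ge0 ?exprn_ge0// ltW.
move: low upp decr; rewrite subr0.
move: (q v) (qform _ E) (`|v| ^+ 3) (`|E| ^+ 3) (u t ^+ 2) (u 0 ^+ 2) cc.
move=> a b V W U1 U0 c; lra.
Qed.

(** The left-hand side is the derivative at time 0 of the squared P-length of an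
    error that starts from v and obeys the linearization of the observer. It is
    the limit as t tends to 0+ of the bound of [rescaled_dist_decrease], once
    divided by t. *)
Theorem variational_inequality :
  qform ('D_(f x) P x) v + 2 * bil (P x) Av v <= - kappa * qform (P x) v.
Proof.
have /choice[S HS] : forall s : R, exists S : (R -> 'rV[R]_n) * (R -> 'rV[R]_n),
    solution_from f h F (x + s *: v) x S.1 S.2.
  by move=> s; have [Xh [X sol]] := fwd (x + s *: v) x; exists (Xh, X).
pose Y t := (S (t ^+ 2)).2 t; pose Yh t := (S (t ^+ 2)).1 t.
pose E t := (t ^+ 2)^-1 *: (Yh t - Y t).
have small (d : R) : 0 < d ->
    \forall t \near 0^'+, 0 < t ^+ 2 <= d /\ 0 <= t <= d.
  move=> d0; near=> t.
  have t0 : 0 < t by near: t; exact: nbhs_right_gt.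
  have t1 : t <= 1 by near: t; exact: nbhs_right_ltW.
  have td : t <= d by near: t; exact: nbhs_right_ltW.
  split; last by rewrite ltW.
  by rewrite exprn_gt0//= (le_trans _ td)// expr2 ler_piMl// ltW.
have cE : t^-1 *: (E t - v) @[t --> 0^'+] --> Av.
  apply/cvgrPdist_le => e e0.
  have [d d0 H] := flow_expansion f_cont h_cont F_diff F_C1 drift x v e0.
  apply: filterS2 (nbhs_right_gt 0) (small d d0) => t t0 [sd td].
  have [_] := H _ t _ _ sd td (HS _); rewrite -/(Y t) -/(Yh t) -/Av => HE.
  have s0 : 0 < t ^+ 2 by rewrite exprn_gt0.
  have -> : Av - t^-1 *: (E t - v) = - ((t ^+ 2)^-1 * t^-1) *:
      (Yh t - Y t - t ^+ 2 *: (v + t *: Av)).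
    rewrite scaleNr -scalerA [_^-1 *: (t^-1 *: _)]scalerA mulrC -scalerA.
    rewrite [(t ^+ 2)^-1 *: (_ - _ *: _)]scalerBr [(t ^+ 2)^-1 *: (_ *: _)]scalerA.
    rewrite mulVf ?gt_eqF// scale1r -/(E t) opprD addrA [in RHS]scalerBr.
    by rewrite scalerA mulVf ?gt_eqF// scale1r opprB.
  rewrite normrZ normrN gtr0_norm ?mulr_gt0 ?invr_gt0//.
  rewrite -invfM mulrC ler_pdivrMr ?mulr_gt0//.
  by rewrite mulrA.
have c0 : t @[t --> (0 : R)^'+] --> (0 : R).
  by apply: cvg_at_right_filter; exact: cvg_id.
have cE0 : E t @[t --> 0^'+] --> v.
  have H : t *: (t^-1 *: (E t - v)) + v @[t --> 0^'+] --> (0 : R) *: Av + v.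
    by apply: cvgD; [exact: cvgZ|exact: cvg_cst].
  rewrite -[X in _ --> X]add0r -(scale0r Av).
  apply: cvg_trans H; apply: near_eq_cvg; near=> t.
  have t0 : t != 0 by near: t; exact: nbhs_right_neq.
  by rewrite scalerA divff// scale1r subrK.
have cX : t^-1 *: (Y t - x) @[t --> 0^'+] --> f x.
  apply/cvgrPdist_le => e e0.
  have [d d0 H] := flow_expansion f_cont h_cont F_diff F_C1 drift x v e0.
  apply: filterS2 (nbhs_right_gt 0) (small d d0) => t t0 [sd td].
  have [+ _] := H _ t _ _ sd td (HS _); rewrite -/(Y t) => HX.
  have -> : f x - t^-1 *: (Y t - x) = - t^-1 *: (Y t - (x + t *: f x)).
    rewrite opprD addrA scaleNr [in RHS]scalerBr scalerA mulVf ?gt_eqF//.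
    by rewrite scale1r opprB.
  rewrite normrZ normrN gtr0_norm ?invr_gt0//.
  by rewrite ler_pdivrMl// mulrC.
pose W t := Yh t - x.
have cW : t^-1 *: W t @[t --> 0^'+] --> f x.
  have H : t^-1 *: (Y t - x) + t *: E t @[t --> 0^'+] --> f x + (0 : R) *: v.
    by apply: cvgD => //; exact: cvgZ.
  rewrite -[X in _ --> X]addr0 -(scale0r v).
  apply: cvg_trans H; apply: near_eq_cvg; near=> t.
  have t0 : t != 0 by near: t; exact: nbhs_right_neq.
  have -> : t *: E t = t^-1 *: (Yh t - Y t).
    rewrite /E scalerA; congr (_ *: _); field; exact: t0.
  by rewrite -scalerDr /W addrC addrA subrK.
have cP := cvg_difference_quotient dP (@cDP x) cW.
pose G t := t^-1 * (qform (P (Yh t)) (E t) - qform (P x) v).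
have cG : G t @[t --> 0^'+] -->
    qform ('D_(f x) P x) v + 2 * bil (P x) Av v.
  have -> : G = fun t => bil (t^-1 *: (P (x + W t) - P x)) (E t) (E t) +
      (bil (P x) (t^-1 *: (E t - v)) (E t) +
       bil (P x) v (t^-1 *: (E t - v))).
    apply/funext => t; rewrite /G /W (addrC x) subrK; move: (E t) => Et.
    rewrite bilZm bilBm bilZl bilZr -!mulrDr; congr (_ * _).
    have bB u w z : bil (P x) (u - w) z = bil (P x) u z - bil (P x) w z.
      by rewrite bilDl -scaleN1r bilZl mulN1r.
    have bB' u w z : bil (P x) z (u - w) = bil (P x) z u - bil (P x) z w.
      by rewrite bilDr -scaleN1r bilZr mulN1r.
    rewrite bB bB' !qform_bil; ring.
  rewrite qform_bil [2 * _]mulr_natl mulr2n {2}(bilC Av v (Psym x)).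
  have cPx : P x @[t --> (0 : R)^'+] --> P x by exact: cvg_cst.
  have cv : v @[t --> (0 : R)^'+] --> v by exact: cvg_cst.
  by apply: cvgD; [exact: cvg_bil|apply: cvgD; exact: cvg_bil].
apply/ler_addgt0Pr => e e0.
(* eta occurs with the factor kappa + 1 in the bound *)
pose eta := e / (kappa + 1).
have k1 : 0 < kappa + 1 by rewrite ltr_wpDl.
have eta0 : 0 < eta by rewrite divr_gt0.
have [K K0 [d d0 H]] := rescaled_dist_decrease eta0.
pose cc := kappa * (qform (P x) v - eta) - eta.
have -> : - kappa * qform (P x) v + e = K * 0 * (1 + `|v| ^+ 3) - cc.
  rewrite /cc /eta; field; exact: lt0r_neq0.
have cR : K * t * (1 + `|E t| ^+ 3) - cc @[t --> 0^'+] -->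
    K * 0 * (1 + `|v| ^+ 3) - cc.
  apply: cvgB; last exact: cvg_cst.
  apply: cvgM; first by apply: cvgM => //; exact: cvg_cst.
  apply: cvgD; first exact: cvg_cst.
  have nE : `|E t| @[t --> 0^'+] --> `|v| by exact: cvg_norm.
  by apply: (cvg_comp _ (fun a : R => a ^+ 3) nE); exact: exprn_continuous.
apply: (ler_cvg_to cG cR).
apply: filterS2 (nbhs_right_gt 0) (small d d0) => t t0 [sd /andP[_ td]].
have t0d : 0 < t <= d by rewrite t0.
have := H t _ _ (E t) t0d (HS _) erefl; rewrite -/(Yh t) -/cc => Hm.
rewrite /G ler_pdivrMl//.
have -> : t * (K * t * (1 + `|E t| ^+ 3) - cc) =
    K * t ^+ 2 + K * t ^+ 2 * `|E t| ^+ 3 - t * cc by ring.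
move: Hm; lra.
Unshelve. all: by end_near. Qed.

End VariationalInequality.

(** * Relation with the Lie derivative and the Hessian *)

Section ObserverDerivatives.
Context {R : realType} {n m : nat}.
Implicit Types (x y z v w : 'rV[R]_n).

Definition second_arg (u : 'rV[R]_m) : 'rV[R]_n * 'rV[R]_m := (0, u).

Lemma second_arg_linear : linear second_arg.
Proof.
move=> a u w; rewrite /second_arg.
have -> : a *: (0 : 'rV[R]_n, u) + (0, w) = (a *: 0 + 0, a *: u + w) by [].
by rewrite scaler0 addr0.
Qed.

HB.instance Definition _ := GRing.isLinear.Build R 'rV[R]_m
  ('rV[R]_n * 'rV[R]_m)%type *:%R second_arg second_arg_linear.

(** Differentiate the identity F(x, h(x)) = f(x). *)
Lemma derive_drift (f : 'rV[R]_n -> 'rV[R]_n) (h : 'rV[R]_n -> 'rV[R]_m)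
    (F : 'rV[R]_n * 'rV[R]_m -> 'rV[R]_n) x v :
  (forall y, F (y, h y) = f y) -> differentiable h x ->
  differentiable F (x, h x) ->
  'D_v f x = 'D_(first_arg v) F (x, h x) +
             'D_(second_arg ('D_v h x)) F (x, h x).
Proof.
move=> drift dh dF.
have dpair : differentiable (fun y => (y, h y)) x.
  exact: differentiable_pair.
have -> : f = F \o (fun y => (y, h y)) by apply/funext => y; rewrite /= drift.
rewrite deriveE; last exact: differentiable_comp.
rewrite diff_comp//= diff_pair//=.
rewrite -(deriveE v (f := id))// derive_id -(deriveE v dh).
have -> : (v, 'D_v h x) = first_arg v + second_arg ('D_v h x).
  rewrite /first_arg /second_arg.
  have -> : (v, 0 : 'rV[R]_m) + (0, 'D_v h x) = (v + 0, 0 + 'D_v h x) by [].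
  by rewrite addr0 add0r.
by rewrite linearD/= !deriveE.
Qed.

Lemma qform_lie_derivative (f : 'rV[R]_n -> 'rV[R]_n) (P : 'rV[R]_n -> 'M[R]_n)
    x v :
  (forall y, (P y)^T = P y) -> differentiable P x -> differentiable f x ->
  qform (lie_derivative f P x) v =
  qform ('D_(f x) P x) v + 2 * bil (P x) ('D_v f x) v.
Proof.
move=> Ps dP df; rewrite lie_derivativeE// !qformD deriveEjacobian//.
rewrite -addrA mulr_natl mulr2n; congr (_ + (_ + _)).
  by rewrite bilC// /bil /qform /jac trmx_mul !mulmxA.
by rewrite /bil /qform /jac trmxK !mulmxA.
Qed.

Lemma qform_gram_jac (h : 'rV[R]_n -> 'rV[R]_m) x v : differentiable h x ->
  qform ((jac h x)^T *m jac h x) v = \sum_j ('D_v h x) 0 j ^+ 2.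
Proof.
move=> dh; rewrite deriveEjacobian// /qform /jac trmxK mulmxA.
rewrite -(mulmxA (v *m _)) -trmx_mul mxE.
by apply: eq_bigr => j _; rewrite [X in _ * X]mxE expr2.
Qed.

Lemma derive_first_arg (W : normedModType R) (G : 'rV[R]_n * 'rV[R]_m -> W) c w y :
  'D_w (fun z => G (z, c)) y = 'D_(first_arg w) G (y, c).
Proof.
have E : (fun a : R => a^-1 *: (G (a *: w + y, c) - G (y, c))) =
    (fun a : R => a^-1 *: (G (a *: first_arg w + (y, c)) - G (y, c))).
  apply/funext => a; rewrite /first_arg.
  have -> : a *: (w, 0 : 'rV[R]_m) + (y, c) = (a *: w + y, a *: 0 + c) by [].
  by rewrite scaler0 add0r.
by rewrite /derive /= E.
Qed.

End ObserverDerivatives.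

Section SecondOrderDecay.
Context {R : realType} {n : nat}.
Implicit Types (x y z v w : 'rV[R]_n).

Lemma qform_hessian (N : set ('rV[R]_n * 'rV[R]_n))
    (g : 'rV[R]_n * 'rV[R]_n -> R) x w :
  open N -> N (x, x) -> Ck_on N 2 g ->
  'D_(first_arg w) ('D_(first_arg w) g) (x, x) =
  qform (hessian (fun z => g (z, x)) x) w.
Proof.
move=> oN Nx C2.
rewrite (derive2_linear_dir [the {linear 'rV[R]_n -> _} of first_arg] w oN Nx C2).
rewrite qformE exchange_big; apply: eq_bigr => j _; apply: eq_bigr => i _.
rewrite /hessian mxE [RHS]mulrAC; congr (_ * _).
have -> : 'D_(delta_mx 0 j) (fun z => g (z, x)) =
    (fun z => 'D_(first_arg (delta_mx 0 j)) g (z, x)).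
  by apply/funext => z; exact: derive_first_arg.
by rewrite (derive_first_arg ('D_(first_arg (delta_mx 0 j)) g)).
Qed.

Variable P : 'rV[R]_n -> 'M[R]_n.
Hypothesis Pm : riemannian_metric P.
Hypothesis Pc : continuous P.
Notation dist := (riemannian_dist P).

(** The function [dist * omega] is nonnegative and vanishes on the diagonal, so
    its second-order Taylor expansion there reduces to the Hessian term. *)
Lemma dist_omega_ge_near_diagonal (omega : 'rV[R]_n * 'rV[R]_n -> R)
    (N : set ('rV[R]_n * 'rV[R]_n)) (eps kappa : R) x :
  (forall p, 0 <= omega p) -> open N -> (forall y, N (y, y)) ->
  Ck_on N 2 (fun p => dist p.1 p.2 * omega p) ->
  loewner_le (eps *: P x) (hessian (fun z => dist z x * omega (z, x)) x) ->
  kappa < eps ->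
  exists2 d, 0 < d & forall z y, `|x - z| < d -> `|x - y| < d ->
    N (z, y) /\ kappa / 2 * qform (P x) (z - y) <= dist z y * omega (z, y).
Proof.
move=> omega0 oN Nxx C2 hess ke.
have [Ps Pp] : (P x)^T = P x /\ pos_def (P x) by exact: Pm.
have [c c0 Hc] := pos_def_coercive Ps Pp.
pose g (p : 'rV[R]_n * 'rV[R]_n) := dist p.1 p.2 * omega p.
have g0 p : 0 <= g p by rewrite mulr_ge0// dist_ge0.
have e0 : 0 < (eps - kappa) * c by rewrite mulr_gt0// subr_gt0.
have [d1 d10 T] := @taylor2_lower _ _ _
  [the {linear 'rV[R]_n -> _} of first_arg] N g (x, x) oN (Nxx x) C2 _ e0.
have /nbhs_ballP[d2 /= d20 HN] : nbhs (x, x) N by exact: open_nbhs_nbhs.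
exists (Num.min d1 d2); first by rewrite lt_min d10.
move=> z y; rewrite !lt_min => /andP[z1 z2] /andP[y1 y2].
split; first by apply: HN; split; rewrite /= -ball_normE.
have pair_lt a b (d : R) : `|x - a| < d -> `|x - b| < d -> `|(x, x) - (a, b)| < d.
  by move=> ad bd; rewrite prod_normE gt_max ad bd.
have zyE : (y, y) + first_arg (z - y) = (z, y).
  rewrite /first_arg; have -> : (y, y) + (z - y, 0) = (y + (z - y), y + 0) by [].
  by rewrite addr0 addrC subrK.
have := T (y, y) (z - y); rewrite zyE.
move=> /(_ (pair_lt _ _ _ y1 y1) (pair_lt _ _ _ z1 y1))[Ny].
have gyy : g (y, y) = 0 by rewrite /g /= distxx// mul0r.
have -> : 'D_(first_arg (z - y)) g (y, y) = 0.
  apply: derive_at_min; last by move=> q; rewrite gyy.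
  by apply: diff_derivable; exact: C2.1.
rewrite gyy !add0r (qform_hessian _ oN (Nxx x) C2) => H.
apply: (le_trans _ H); rewrite mulrAC ler_pM2r//.
have := hess (z - y); rewrite [qform (eps *: _) _]qform_bil bilZm -qform_bil.
have := Hc (z - y); move/(ler_wpM2l (ltW (_ : 0 < eps - kappa))).
rewrite subr_gt0 => /(_ ke); rewrite mulrA mulrBl; lra.
Qed.

End SecondOrderDecay.

Section LieDerivativeBound.
Context {R : realType} {n m : nat}.
Implicit Types (x y z v w : 'rV[R]_n).
Variables (f : 'rV[R]_n -> 'rV[R]_n) (h : 'rV[R]_n -> 'rV[R]_m)
  (F : 'rV[R]_n * 'rV[R]_m -> 'rV[R]_n) (P : 'rV[R]_n -> 'M[R]_n).

Let b k x := 'D_(second_arg (delta_mx 0 k)) F (x, h x).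

(** By [derive_drift] the Lie derivative exceeds the variational term by a cross
    term between v and the derivative of h along v, which Young's inequality
    splits coordinate by coordinate. *)
Lemma lie_derivative_le (mu : R) x v :
  riemannian_metric P -> differentiable P x -> differentiable h x ->
  differentiable f x -> differentiable F (x, h x) ->
  (forall y, F (y, h y) = f y) -> 0 < mu ->
  qform (lie_derivative f P x) v <=
    qform ('D_(f x) P x) v + 2 * bil (P x) ('D_(first_arg v) F (x, h x)) v +
    mu * m%:R * qform (P x) v +
    (mu^-1 * \sum_k qform (P x) (b k x)) *
      qform ((jac h x)^T *m jac h x) v.
Proof.
move=> Pm dP dh df dF drift mu0.
have [Ps Pp] : (P x)^T = P x /\ pos_def (P x) by exact: Pm.
rewrite qform_lie_derivative//; last by move=> y; case: (Pm y).
rewrite (derive_drift v drift dh dF) bilDl mulrDr addrA -!addrA !lerD2l.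
set u := 'D_v h x.
have -> : 'D_(second_arg u) F (x, h x) = \sum_k u 0 k *: b k x.
  exact: (derive_linear_dir [the {linear 'rV[R]_m -> _} of second_arg]).
rewrite bilC// bil_sumr mulr_sumr qform_gram_jac//.
have term k : 2 * bil (P x) v (u 0 k *: b k x) <=
    mu * qform (P x) v + mu^-1 * (u 0 k ^+ 2 * qform (P x) (b k x)).
  rewrite bilZr -(ler_pM2l mu0).
  have -> : mu * (mu * qform (P x) v +
      mu^-1 * (u 0 k ^+ 2 * qform (P x) (b k x))) =
      mu ^+ 2 * qform (P x) v + u 0 k ^+ 2 * qform (P x) (b k x).
    by field; rewrite gt_eqF.
  apply: le_trans (bil_young v (b k x) mu (u 0 k) Ps Pp).
  by rewrite le_eqVlt; apply/orP; left; apply/eqP; ring.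
apply: (le_trans (ler_sum _ (fun k _ => term k))).
rewrite big_split/= sumr_const card_ord -[X in X + _]mulr_natr mulrAC lerD2l.
rewrite -mulr_sumr -mulrA ler_wpM2l ?invr_ge0 ?(ltW mu0)//.
rewrite mulr_sumr; apply: ler_sum => k _; rewrite mulrC ler_wpM2r ?sqr_ge0//.
rewrite (bigD1 k)//= lerDl sumr_ge0// => j _; exact: qform_ge0.
Qed.

End LieDerivativeBound.

Theorem theorem2p3 (R : realType) (n m : nat)
  (f : 'rV[R]_n -> 'rV[R]_n) (h : 'rV[R]_n -> 'rV[R]_m)
  (F : 'rV[R]_n * 'rV[R]_m -> 'rV[R]_n)
  (f_C1 : Ck 1 f) (h_C1 : Ck 1 h) (F_C1 : Ck 1 F)
  (fwd : forward_complete f h F)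
  (P : 'rV[R]_n -> 'M[R]_n)
  (P_metric : riemannian_metric P) (P_C3 : Ck 3 P)
  (P_complete : complete_metric P)
  (dini_le0 : forall xh x : 'rV[R]_n, dini_dist_le f h F P xh x 0) :
  (forall x v : 'rV[R]_n,
     jac h x *m v^T = 0 -> qform (lie_derivative f P x) v <= 0)
  /\
  (forall (omega : 'rV[R]_n * 'rV[R]_n -> R)
          (N : set ('rV[R]_n * 'rV[R]_n)) (eps : R),
     (forall p, 0 <= omega p) ->
     open N -> (forall x : 'rV[R]_n, N (x, x)) ->
     Ck_on N 2 (fun p => riemannian_dist P p.1 p.2 * omega p) ->
     0 < eps ->
     (forall x : 'rV[R]_n,
        loewner_le (eps *: P x)
          (hessian (fun xh => riemannian_dist P xh x * omega (xh, x)) x)) ->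
     (forall xh x : 'rV[R]_n,
        N (xh, x) -> dini_dist_le f h F P xh x (- omega (xh, x))) ->
     exists2 rho : 'rV[R]_n -> R, continuous rho &
       forall x : 'rV[R]_n,
         loewner_le (lie_derivative f P x)
           (rho x *: ((jac h x)^T *m jac h x) - (eps / 2) *: P x)).
Proof.
have dP x : differentiable P x by exact: P_C3.1.
have cDP x i : {for x, continuous ('D_(delta_mx 0 i) P)}.
  by apply: differentiable_continuous; exact: (P_C3.2 _).1.
have Pc : continuous P by move=> x; exact: differentiable_continuous.
have df x : differentiable f x by exact: f_C1.1.
have dh x : differentiable h x by exact: h_C1.1.
have dF p : differentiable F p by exact: F_C1.1.
have fc : continuous f by move=> x; exact: differentiable_continuous.
have hc : continuous h by move=> x; exact: differentiable_continuous.
have cDF u p : {for p, continuous ('D_u F)} by exact: F_C1.2.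
have drift x : F (x, h x) = f x by apply: (drift_eq fwd P_metric dP cDP).
have key := variational_inequality fc hc dF cDF drift fwd P_metric dP cDP.
split.
  move=> x v hv; rewrite qform_lie_derivative//; last by move=> y; case: (P_metric y).
  have -> : 'D_v f x = 'D_(first_arg v) F (x, h x).
    rewrite (derive_drift v drift (dh x) (dF _)).
    have -> : 'D_v h x = 0.
      rewrite deriveEjacobian// -[LHS]trmxK trmx_mul.
      by move: hv; rewrite /jac => ->; rewrite trmx0.
    by rewrite [second_arg 0]linear0 [X in _ + X]deriveE// linear0 addr0.
  have K : qform ('D_(f x) P x) v + 2 * bil (P x) ('D_(first_arg v) F (x, h x)) v
      <= - 0 * qform (P x) v.
    apply: key => //; exists 1 => // z y _ _; exists 0.
    by split; [rewrite oppr0|rewrite !mul0r mulr0].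
  by move: K; rewrite oppr0 mul0r.
move=> omega N eps omega0 oN Nxx C2 eps0 hess dini_omega.
(* the margin eps / 4 between kappa and eps / 2 absorbs the term
   mu * m * P of the Young bound *)
pose kappa := 3 / 4 * eps.
have kappa0 : 0 <= kappa by rewrite mulr_ge0 ?divr_ge0// ltW.
have ke : kappa < eps by rewrite /kappa; lra.
pose mu := eps / (4 * (m%:R + 1)).
have m1 : 0 < m%:R + 1 :> R by rewrite ltr_wpDl.
have mu0 : 0 < mu by rewrite divr_gt0// mulr_gt0.
pose b k x := 'D_(second_arg (delta_mx 0 k)) F (x, h x).
exists (fun x => mu^-1 * \sum_k qform (P x) (b k x)).
  move=> x; have nx : Filter (nbhs x) by exact: nbhs_filter.
  apply: cvgM; first exact: cvg_cst.
  apply: (@cvg_sumr R R^o) => k.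
  have cb : b k y @[y --> x] --> b k x.
    have ci : y @[y --> x] --> x by exact: cvg_id.
    have ch : h y @[y --> x] --> h x by exact: hc.
    have cp : (y, h y) @[y --> x] --> (x, h x) by exact: (cvg_pair ci ch).
    have cF : 'D_(second_arg (delta_mx 0 k)) F p @[p --> (x, h x)] --> b k x.
      exact: cDF.
    exact: (cvg_comp _ _ cp cF).
  have cP : P y @[y --> x] --> P x by exact: Pc.
  exact: (cvg_bil cP cb cb).
move=> x v; have [Ps Pp] : (P x)^T = P x /\ pos_def (P x) by exact: P_metric.
have := lie_derivative_le v P_metric (dP x) (dh x) (df x) (dF _) drift mu0.
move=> /le_trans; apply.
have K : qform ('D_(f x) P x) v + 2 * bil (P x) ('D_(first_arg v) F (x, h x)) v <=
    - kappa * qform (P x) v.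
  apply: key => //.
  have [d d0 H] := dist_omega_ge_near_diagonal P_metric Pc omega0 oN Nxx C2
    (hess x) ke.
  exists d => // z y zd yd; have [Nzy Hzy] := H z y zd yd.
  by exists (omega (z, y)); split => //; exact: dini_omega.

rewrite [leRHS]qform_bil bilBm !bilZm -!qform_bil.
rewrite [leRHS]addrC lerD2r.
have q0 : 0 <= qform (P x) v by exact: qform_ge0.
have : mu * m%:R * qform (P x) v <= eps / 4 * qform (P x) v.
  rewrite ler_wpM2r// /mu invfM mulrA -mulrA ler_piMr ?divr_ge0 ?(ltW eps0)//.
  by rewrite mulrC ler_pdivrMr// mul1r lerDl.
by move: K; rewrite /kappa; lra.
Qed.
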